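(* There exist absolute constants $c>0$ and $C>0$ such that the following holds. Let $p$ be a prime, $n\geq 3$, $V$ an $n$-dimensional vector space over $\mathbb{F}_p$, and let $X\subseteq SL(V)$ be a symmetric generating set of $SL(V)$ with $1\in X$ which contains a transvection. Then for some $l\le C(\log p)^c n^2$, the set $X^l$ contains a full transvection group $s^{\mathbb{F}_p}$ for some transvection $s$.
   Context: A transvection is an element $s=1+d\otimes\phi\in SL(V)$, acting by $x\mapsto x+\phi(x)d$, with $0\neq d\in V$, $0\neq \phi\in V^*$, $\phi(d)=0$; its transvection group is $s^{\mathbb{F}_p}=\{1+\lambda\, d\otimes\phi:\lambda\in\mathbb{F}_p\}$. For $k\in\mathbb{N}$, $X^k=\{x_1\cdots x_k: x_i\in X\}$ (since $1\in X$, $X^k\subseteq X^l$ for $k\le l$). *)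

(* Defs.v *)
From Stdlib Require Import Reals.
From mathcomp Require Import all_boot all_order all_algebra all_fingroup.
Set Implicit Arguments. Unset Strict Implicit. Unset Printing Implicit Defensive.
Import GRing.Theory.

Definition len_bound (C c : R) (p n : nat) : R :=
  Rmult (Rmult C (Rpower (ln (INR p)) c)) (pow (INR n) 2).

Local Open Scope ring_scope.

Section Defs.
Variables (F : fieldType) (n : nat).
Local Notation M := 'M[F]_n.

Definition in_SL (g : M) : Prop := \det g = 1.

(* s = 1 + d (x) phi, acting by x |-> x + phi(x) d, d != 0, phi != 0, phi(d)=0 *)
Definition is_transvection (s : M) : Prop :=
  exists (d : 'cV[F]_n) (phi : 'rV[F]_n),
    [/\ d != 0, phi != 0, phi *m d = 0 & s = 1%:M + d *m phi].

(* transvection group s^F = {1 + lambda d (x) phi : lambda in F}; note d(x)phi = s - 1 *)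
Definition transvection_group (s : M) : M -> Prop :=
  fun g => exists lambda : F, g = 1%:M + lambda *: (s - 1%:M).

Inductive in_gen (X : M -> Prop) : M -> Prop :=
| gen_elem x : X x -> in_gen X x
| gen_one : in_gen X 1%:M
| gen_mul x y : in_gen X x -> in_gen X y -> in_gen X (x *m y)
| gen_inv x : in_gen X x -> in_gen X (invmx x).

Fixpoint setpow (X : M -> Prop) (k : nat) : M -> Prop :=
  match k with
  | 0 => fun g => g = 1%:M
  | k'.+1 => fun g => exists a b, setpow X k' a /\ X b /\ g = a *m b
  end.
End Defs.

(* Main.v *)
(* Let [t = 1 + d phi] be the given transvection.  The condition
   [phi (g d) <> 0 <> phi (g^-1 d)] is the nonvanishing of a linear functional at
   [g (d phi) g^-1], so some [g] in [X ^ (n ^ 2)] satisfies it.  Then [t] and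
   [g t g^-1] generate a copy of SL2 in which they become [u(1)] (upper
   unitriangular) and [l(c)] (lower unitriangular) for some [c <> 0], and it
   suffices to write every [u(x)] as a word of polylogarithmic length in these.

   Let [A] be a ball in this copy of SL2(F_p).  If [|A ^ 18| > |A| ^ (27/26)]
   at every scale, then [A] exceeds SL2(F_p) after O(log log p) steps; so there is
   a scale of polylogarithmic radius without such growth.  There:
   - [A ^ 8] has at most about [|A| ^ (3/4)] elements of trace 2.  Otherwise many
     products of two such elements coincide, hence many of them lie on one conic
     of the nilpotent cone, and two conics of this kind meet in boundedly many
     points, so the products of elements on that conic are too numerous.
   - By orbit-stabiliser, every line fixed by a nontrivial unipotent of [A ^ 6] is
     then fixed by at least [|A| ^ (1/4)] unipotents of [A ^ 4].  The property is
     thereby transported by the generators, hence holds for [p] lines, which forces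
     [|A|] to be nearly [p ^ 2].
   - By the pigeonhole principle on the projective line, [A ^ 2] contains many upper
     triangular elements.  They act on [{x | u(x) short}] by the squares of their
     eigenvalues, and the sum-product phenomenon, applied twice, makes this set all
     of F_p. *)
Require Import Defs.
From Stdlib Require Import Reals Lra.
From HB Require Import structures.
From mathcomp Require Import all_boot all_order all_algebra all_fingroup.
Set Implicit Arguments. Unset Strict Implicit. Unset Printing Implicit Defensive.
Import GRing.Theory.

Delimit Scope R_scope with Re.

(** * Polylogarithmic bound *)

Lemma INR_expn (m k : nat) : INR (expn m k) = pow (INR m) k.
Proof.
elim: k => [|k IHk] //.
by rewrite expnS -[(m * _)%N]/(Nat.mul m _) mult_INR IHk.
Qed.

(** After taking logarithms the hypothesis reads [(27 / 26) ^ n <= 4 / ln 2 * ln p], and [18 ^ n] is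
    the [c]-th power of the left side. *)
Lemma pow18_le (p n : nat) : (1 < p)%N -> (2 ^ (27 ^ n) <= p ^ (4 * 26 ^ n))%N ->
  let c := Rdiv (ln 18) (ln (27 / 26)) in
  Rle (pow 18 n) (Rmult (Rpower (4 / ln 2) c) (Rpower (ln (INR p)) c)).
Proof.
move=> p1 pn c.
have p1R : (1 < INR p)%Re by apply: (lt_INR 1); apply/ltP.
have lnp : (0 < ln (INR p))%Re by rewrite -ln_1; apply: ln_increasing; lra.
have ln2 : (0 < ln 2)%Re by rewrite -ln_1; apply: ln_increasing; lra.
have ln18 : (0 < ln 18)%Re by rewrite -ln_1; apply: ln_increasing; lra.
have lnq : (0 < ln (27 / 26))%Re by rewrite -ln_1; apply: ln_increasing; lra.
have pow26 : (0 < pow 26 n)%Re by apply: pow_lt; lra.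
have pow27 : (0 < pow 27 n)%Re by apply: pow_lt; lra.
have le1 : (pow 27 n * ln 2 <= 4 * pow 26 n * ln (INR p))%Re.
  have := le_INR _ _ (elimT leP pn); rewrite !INR_expn => le_pow.
  have INRn m : INR m = IZR (Z.of_nat m) by apply: INR_IZR_INZ.
  have -> : (pow 27 n = INR (27 ^ n))%Re by rewrite INR_expn INRn.
  have -> : (4 * pow 26 n = INR (4 * 26 ^ n))%Re.
    by rewrite -[(4 * _)%N]/(Nat.mul 4 _) mult_INR INR_expn !INRn.
  rewrite -ln_pow; last lra.
  rewrite -ln_pow; last lra.
  have -> : 2%Re = INR 2 by rewrite INRn.
  have [lt|->] := Rle_lt_or_eq_dec _ _ le_pow; last exact: Rle_refl.
  by left; apply: ln_increasing => //; apply: pow_lt; apply: (lt_INR 0); apply/ltP.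
have x_gt0 : (0 < 4 / ln 2 * ln (INR p))%Re.
  by apply: Rmult_lt_0_compat => //; apply: Rdiv_lt_0_compat => //; lra.
have le2 : (pow (27 / 26) n <= 4 / ln 2 * ln (INR p))%Re.
  have -> : (pow (27 / 26) n = pow 27 n / pow 26 n)%Re.
    by rewrite /Rdiv Rpow_mult_distr pow_inv.
  apply: (Rmult_le_reg_r (pow 26 n * ln 2)); first exact: Rmult_lt_0_compat.
  have -> : (27 ^ n / 26 ^ n * (26 ^ n * ln 2) = 27 ^ n * ln 2)%Re by field; lra.
  by have -> : (4 / ln 2 * ln (INR p) * (26 ^ n * ln 2) = 4 * 26 ^ n * ln (INR p))%Re by field; lra.
rewrite Rpower_mult_distr //; last by apply: Rdiv_lt_0_compat => //; lra.
rewrite -Rpower_pow; last lra.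
rewrite /Rpower.
have le3 : (INR n * ln (27 / 26) <= ln (4 / ln 2 * ln (INR p)))%Re.
  rewrite -ln_pow; last lra.
  have [lt|->] := Rle_lt_or_eq_dec _ _ le2; last exact: Rle_refl.
  by left; apply: ln_increasing => //; apply: pow_lt; lra.
have le4 : (INR n * ln 18 <= c * ln (4 / ln 2 * ln (INR p)))%Re.
  have -> : (INR n * ln 18 = c * (INR n * ln (27 / 26)))%Re by rewrite /c; field; lra.
  by apply: Rmult_le_compat_l => //; left; apply: Rdiv_lt_0_compat.
have [lt|->] := Rle_lt_or_eq_dec _ _ le4; last exact: Rle_refl.
by left; apply: exp_increasing.
Qed.

(** Here [m] is the index of a scale without growth, [k] a word length in SL2, and [2 * n ^ 2 + 1]
    the cost in [X] of one letter of such a word. *)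
Lemma len_bound_exists (D : nat) : exists c C : R, Rlt 0 c /\ Rlt 0 C /\
  forall p n k m : nat, (1 < p)%N -> (0 < n)%N -> (k <= D * 18 ^ m)%N ->
    (2 ^ (27 ^ m) <= p ^ (4 * 26 ^ m))%N ->
    Rle (INR ((2 * n ^ 2 + 1) * k)) (len_bound C c p n).
Proof.
pose c := Rdiv (ln 18) (ln (27 / 26)).
(* The [+ 1] keeps the constant positive when [D] is 0; the factor 3 below comes from
   [2 * n ^ 2 + 1 <= 3 * n ^ 2]. *)
pose C0 := (INR D + 1)%Re; pose C1 := Rpower (4 / ln 2) c.
have C0_gt0 : (0 < C0)%Re by rewrite /C0; have := pos_INR D; lra.
have C1_gt0 : (0 < C1)%Re by apply: exp_pos.
exists c, (3 * C0 * C1)%Re; split.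
  apply: Rdiv_lt_0_compat; rewrite -ln_1; apply: ln_increasing; lra.
split; first by apply: Rmult_lt_0_compat => //; apply: Rmult_lt_0_compat => //; lra.
move=> p n k m p1 n0 kD pm.
have pow_le := pow18_le p1 pm; rewrite -/c -/C1 in pow_le.
have k_le : (INR k <= C0 * pow 18 m)%Re.
  have := le_INR _ _ (elimT leP kD).
  rewrite -[(D * _)%N]/(Nat.mul D _) mult_INR INR_expn (INR_IZR_INZ 18) /= => kle.
  apply: Rle_trans kle _; apply: Rmult_le_compat_r; first by left; apply: pow_lt; lra.
  by rewrite /C0; lra.
have n_le : (INR (2 * n ^ 2 + 1) <= 3 * pow (INR n) 2)%Re.
  rewrite -[(_ + 1)%N]/(Nat.add _ 1) plus_INR -[(2 * _)%N]/(Nat.mul 2 _) mult_INR INR_expn.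
  have n1 : (1 <= INR n)%Re by apply: (le_INR 1); apply/leP.
  by rewrite /=; nra.
rewrite /len_bound -[(_ * k)%N]/(Nat.mul _ k) mult_INR.
have -> : (3 * C0 * C1 * Rpower (ln (INR p)) c * pow (INR n) 2 =
  3 * pow (INR n) 2 * (C0 * (C1 * Rpower (ln (INR p)) c)))%Re by ring.
apply: Rmult_le_compat => //; try exact: pos_INR.
by apply: Rle_trans k_le _; apply: Rmult_le_compat_l => //; lra.
Qed.

From mathcomp Require Import ring zify boolp.

(** * Symmetric subsets of finite groups *)

Section Counting.
Variables (aT rT : finType).

Lemma leq_card_fiber (f : aT -> rT) (D : {set aT}) (n : nat) :
  (forall x, x \in D -> #|[set y in D | f y == f x]| <= n) ->
  #|D| <= #|f @: D| * n.
Proof.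
move=> fibn; rewrite -sum1_card (partition_big_imset f) /= -sum_nat_const.
apply: leq_sum => _ /imsetP[x xD ->].
by rewrite sum1dep_card; apply: leq_trans (fibn x xD); rewrite subset_leq_card //; apply/subsetP=> y; rewrite !inE.
Qed.

Lemma leq_card_inj (f : aT -> rT) (D : {set aT}) (E : {set rT}) :
  {in D, forall x, f x \in E} -> {in D &, injective f} -> #|D| <= #|E|.
Proof.
move=> fDE f_inj; rewrite -(card_in_imset f_inj); apply: subset_leq_card.
by apply/subsetP=> _ /imsetP[x xD ->]; apply: fDE.
Qed.

End Counting.

Section SetPowers.
Variable gT : finGroupType.
Implicit Types (A X : {set gT}) (s x : gT).
Local Open Scope group_scope.

(** Orbit-stabiliser for a set: if [a] and [b] conjugate [s] to the same element, then [b * a^-1]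
    centralises [s]. *)
Lemma leq_card_conj_class A s :
  (#|A| <= #|[set (s ^ a)%g | a in A]| * #|((A * A^-1) :&: 'C[s])%g|)%N.
Proof.
apply: (@leq_card_fiber _ _ (fun a => s ^ a)) => a aA.
apply: (@leq_card_inj _ _ (fun b => b * a^-1)) => [b|b1 b2 _ _ /mulIg //].
rewrite inE => /andP[bA /eqP sba]; rewrite in_setI mem_mulg ?memV_invg //=; apply/cent1P/commute_sym/commgP/conjg_fixP.
by rewrite conjgM sba conjgK.
Qed.

Variable X : {set gT}.
Hypotheses (X1 : 1 \in X) (XV : X^-1 = X).

Lemma expX_invg k : (X ^+ k)^-1 = X ^+ k.
Proof.
elim: k => [|k IHk]; first by rewrite !expg0 invg1.
by rewrite {1}expgS invMg IHk XV -expgSr.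
Qed.

Lemma expX_mul i j x y : x \in X ^+ i -> y \in X ^+ j -> x * y \in X ^+ (i + j).
Proof. by rewrite expgD; apply: mem_mulg. Qed.

Lemma expX_inv k x : x \in X ^+ k -> x^-1 \in X ^+ k.
Proof. by rewrite -{2}(expX_invg k) memV_invg. Qed.

Lemma expX_one k : 1 \in X ^+ k.
Proof.
by elim: k => [|k IHk]; rewrite ?expg0 ?set11 // expgS -(mulg1 1) mem_mulg.
Qed.

Lemma expX_sub i j : (i <= j)%N -> X ^+ i \subset X ^+ j.
Proof.
move=> /subnK <-; apply/subsetP=> x xi.
by rewrite -(mul1g x) expX_mul ?expX_one.
Qed.

Lemma expX_le i j x : (i <= j)%N -> x \in X ^+ i -> x \in X ^+ j.
Proof. by move=> /expX_sub /subsetP; apply. Qed.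

Lemma expX_conj i j s a : s \in X ^+ i -> a \in X ^+ j -> s ^ a \in X ^+ (j + i + j).
Proof. by move=> si aj; rewrite conjgE mulgA; do 2!apply: expX_mul => //; apply: expX_inv. Qed.

End SetPowers.

(** * The group SL2 and its unipotent elements *)

Section SL2Type.
Variable F : finFieldType.
Local Open Scope ring_scope.

Definition det_one (m : F * F * F * F) : bool :=
  m.1.1.1 * m.2 - m.1.1.2 * m.1.2 == 1.

Record SL2 := MkSL2 { SL2val : F * F * F * F; _ : det_one SL2val }.

HB.instance Definition _ := [isSub for SL2val].
HB.instance Definition _ := [Finite of SL2 by <:].

Definition e11 (g : SL2) := (val g).1.1.1.
Definition e12 (g : SL2) := (val g).1.1.2.
Definition e21 (g : SL2) := (val g).1.2.
Definition e22 (g : SL2) := (val g).2.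

Lemma SL2_det g : e11 g * e22 g - e12 g * e21 g = 1.
Proof. exact/eqP/(valP g). Qed.

Lemma SL2_eq g h :
  e11 g = e11 h -> e12 g = e12 h -> e21 g = e21 h -> e22 g = e22 h -> g = h.
Proof.
move=> E11 E12 E21 E22; apply: val_inj; move: E11 E12 E21 E22.
rewrite /e11 /e12 /e21 /e22; case: (val g) (val h) => [[[a b] c] d] [[[a' b'] c'] d'] /=.
by move=> -> -> -> ->.
Qed.

Definition mk (a b c d : F) (abcd : a * d - b * c = 1) : SL2 :=
  @MkSL2 (a, b, c, d) (introT eqP abcd).

Fact SL2_mul_subproof g h :
  (e11 g * e11 h + e12 g * e21 h) * (e21 g * e12 h + e22 g * e22 h) -
  (e11 g * e12 h + e12 g * e22 h) * (e21 g * e11 h + e22 g * e21 h) = 1.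
Proof. by rewrite -[RHS](mulr1 1) -{1}(SL2_det g) -(SL2_det h); ring. Qed.

Fact SL2_one_subproof : 1 * 1 - 0 * 0 = 1 :> F.
Proof. by ring. Qed.

Fact SL2_inv_subproof g : e22 g * e11 g - (- e12 g) * (- e21 g) = 1.
Proof. by rewrite -(SL2_det g); ring. Qed.

Definition SL2_mul g h := mk (SL2_mul_subproof g h).
Definition SL2_one := mk SL2_one_subproof.
Definition SL2_inv g := mk (SL2_inv_subproof g).

Fact SL2_mulA : associative SL2_mul.
Proof.
by move=> x y z; apply: SL2_eq; rewrite /SL2_mul /e11 /e12 /e21 /e22 /=; ring.
Qed.

Fact SL2_mul1 : left_id SL2_one SL2_mul.
Proof.
by move=> x; apply: SL2_eq; rewrite /SL2_mul /e11 /e12 /e21 /e22 /=; ring.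
Qed.

Fact SL2_mulV : left_inverse SL2_one SL2_inv SL2_mul.
Proof.
move=> x; have := SL2_det x; rewrite /e11 /e12 /e21 /e22 => detx.
by apply: SL2_eq; rewrite /SL2_mul /e11 /e12 /e21 /e22 /= -?detx; ring.
Qed.

HB.instance Definition _ := Finite_isGroup.Build SL2 SL2_mulA SL2_mul1 SL2_mulV.

End SL2Type.

Section SL2Theory.
Variable F : finFieldType.
Local Notation G := (SL2 F).
Local Open Scope ring_scope.
Implicit Types (g h s : G) (x y z k : F).

Lemma e11M g h : e11 (g * h)%g = e11 g * e11 h + e12 g * e21 h. Proof. by []. Qed.
Lemma e12M g h : e12 (g * h)%g = e11 g * e12 h + e12 g * e22 h. Proof. by []. Qed.
Lemma e21M g h : e21 (g * h)%g = e21 g * e11 h + e22 g * e21 h. Proof. by []. Qed.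
Lemma e22M g h : e22 (g * h)%g = e21 g * e12 h + e22 g * e22 h. Proof. by []. Qed.
Lemma e11V g : e11 (g^-1)%g = e22 g. Proof. by []. Qed.
Lemma e12V g : e12 (g^-1)%g = - e12 g. Proof. by []. Qed.
Lemma e21V g : e21 (g^-1)%g = - e21 g. Proof. by []. Qed.
Lemma e22V g : e22 (g^-1)%g = e11 g. Proof. by []. Qed.
Lemma e11_1 : e11 (1%g : G) = 1. Proof. by []. Qed.
Lemma e12_1 : e12 (1%g : G) = 0. Proof. by []. Qed.
Lemma e21_1 : e21 (1%g : G) = 0. Proof. by []. Qed.
Lemma e22_1 : e22 (1%g : G) = 1. Proof. by []. Qed.

Definition SL2E := (e11M, e12M, e21M, e22M, (e11V, e12V, e21V, e22V),
  (e11_1, e12_1, e21_1, e22_1)).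

Definition tr g := e11 g + e22 g.

Fact tv_subproof k x y :
  (1 + k * x * y) * (1 - k * x * y) - (- (k * x ^+ 2)) * (k * y ^+ 2) = 1.
Proof. by ring. Qed.

(* The map [w |-> w - k * det (v, w) * v] with [v = (x, y)]: every element of
   trace 2 has this form, and [v] spans the line it fixes. *)
Definition tv k x y : G := mk (tv_subproof k x y).

Lemma e11_tv k x y : e11 (tv k x y) = 1 + k * x * y. Proof. by []. Qed.
Lemma e12_tv k x y : e12 (tv k x y) = - (k * x ^+ 2). Proof. by []. Qed.
Lemma e21_tv k x y : e21 (tv k x y) = k * y ^+ 2. Proof. by []. Qed.
Lemma e22_tv k x y : e22 (tv k x y) = 1 - k * x * y. Proof. by []. Qed.
Definition tvE := (e11_tv, e12_tv, e21_tv, e22_tv).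

(** The sign makes [x] the upper right entry. *)
Definition upper x : G := tv (- x) 1 0.
Definition lower y : G := tv y 0 1.

Lemma e11_up x : e11 (upper x) = 1. Proof. by rewrite tvE; ring. Qed.
Lemma e12_up x : e12 (upper x) = x. Proof. by rewrite tvE; ring. Qed.
Lemma e21_up x : e21 (upper x) = 0. Proof. by rewrite tvE; ring. Qed.
Lemma e22_up x : e22 (upper x) = 1. Proof. by rewrite tvE; ring. Qed.
Lemma e11_lo x : e11 (lower x) = 1. Proof. by rewrite tvE; ring. Qed.
Lemma e12_lo x : e12 (lower x) = 0. Proof. by rewrite tvE; ring. Qed.
Lemma e21_lo x : e21 (lower x) = x. Proof. by rewrite tvE; ring. Qed.
Lemma e22_lo x : e22 (lower x) = 1. Proof. by rewrite tvE; ring. Qed.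
Definition upE := (e11_up, e12_up, e21_up, e22_up, (e11_lo, e12_lo, e21_lo, e22_lo)).

Lemma tr_tv k x y : tr (tv k x y) = 2%:R.
Proof. by rewrite /tr !tvE; ring. Qed.

Lemma tvD k k' x y : tv (k + k') x y = (tv k x y * tv k' x y)%g.
Proof. by apply: SL2_eq; rewrite !SL2E !tvE; ring. Qed.

Lemma tv0 x y : tv 0 x y = 1%g.
Proof. by apply: SL2_eq; rewrite !SL2E !tvE; ring. Qed.

Lemma tvN k x y : tv (- k) x y = (tv k x y)^-1%g.
Proof. by apply: SL2_eq; rewrite !SL2E !tvE; ring. Qed.

(** As [g] preserves determinants, conjugation only moves the fixed vector. This carries unipotents
    from one line to another. *)
Lemma tvJ g k x y :
  (g * tv k x y * g^-1)%g = tv k (e11 g * x + e12 g * y) (e21 g * x + e22 g * y).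
Proof.
have gd : e11 g * e22 g = 1 + e12 g * e21 g by rewrite -(SL2_det g) addrNK.
by apply: SL2_eq; rewrite !SL2E !tvE /=; ring: gd.
Qed.

Lemma upD x y : upper (x + y) = (upper x * upper y)%g.
Proof. by rewrite /upper opprD tvD. Qed.

Lemma up0 : upper 0 = 1%g.
Proof. by rewrite /upper oppr0 tv0. Qed.

Lemma upN x : upper (- x) = (upper x)^-1%g.
Proof. by rewrite /upper tvN. Qed.

Lemma up_inj : injective upper.
Proof. by move=> x y /(congr1 (@e12 F)); rewrite !upE. Qed.

Lemma tv_inj x y : (x, y) != (0, 0) -> injective (fun k => tv k x y).
Proof.
move=> xy0 k k' Ek.
have := congr1 (@e12 F) Ek; have := congr1 (@e21 F) Ek; rewrite !tvE.
have [x0|x0] := eqVneq x 0; last by move=> _ /oppr_inj /(mulIf (expf_neq0 2 x0)).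
have [y0|y0] := eqVneq y 0; last by move=> /(mulIf (expf_neq0 2 y0)).
by case/eqP: xy0; rewrite x0 y0.
Qed.

End SL2Theory.

Section Geometry.
Variable F : finFieldType.
Local Notation G := (SL2 F).
Local Open Scope ring_scope.
Implicit Types (g h s : G) (x y z k : F).

Lemma SL2_diag_mul g : e11 g * e22 g = 1 + e12 g * e21 g.
Proof. by rewrite -(SL2_det g) addrNK. Qed.

Lemma tr_conj s g : tr (g * s * g^-1)%g = tr s.
Proof. by rewrite /tr !SL2E; ring: (SL2_diag_mul g). Qed.

Lemma up_centralizer x (z : G) : x != 0 -> z \in 'C[upper x : G]%g ->
  [/\ e21 z = 0, e22 z = e11 z & (e11 z == 1) || (e11 z == -1)].
Proof.
move=> x0 /cent1P zC.
have := congr1 (@e11 F) zC; have := congr1 (@e12 F) zC; rewrite !SL2E !upE.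
move=> E12 E11.
have z21 : e21 z = 0.
  apply: (mulfI x0); apply: (addrI (e11 z)).
  by transitivity (e11 z * 1 + e12 z * 0); [rewrite E11|]; ring.
have z22 : e22 z = e11 z.
  apply: (mulfI x0); apply: (addrI (e12 z)).
  by transitivity (1 * e12 z + x * e22 z); [|rewrite -E12]; ring.
split=> //; rewrite -eqf_sqr; apply/eqP.
by have := SL2_det z; rewrite z21 z22 => Ez; rewrite expr1n -[RHS]Ez; ring.
Qed.

Lemma upP (z : G) : e21 z = 0 -> e22 z = e11 z -> e11 z = 1 -> z = upper (e12 z).
Proof.
by move=> z21 z22 z11; apply: SL2_eq; rewrite !upE ?z21 ?z22 ?z11.
Qed.

Lemma SL2_first_column x y : (x, y) != (0, 0) ->
  exists g, e11 g = x /\ e21 g = y.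
Proof.
move=> xy0; have [x0|x0] := eqVneq x 0.
  have y0 : y != 0 by apply: contraNneq xy0 => ->; rewrite x0.
  have d : 0 * 0 - (- y^-1) * y = 1 by field.
  by exists (mk d); rewrite x0.
have d : x * x^-1 - 0 * y = 1 by field.
by exists (mk d).
Qed.

(** A fixed vector is [(1, 0)] if [e21 s = 0], and [((e11 s - 1) / e21 s, 1)] otherwise. The
    identity is the case [k = 0]. *)
Lemma tr2P s : tr s = 2%:R -> exists k x y, (x, y) != (0, 0) /\ s = tv k x y.
Proof.
move=> trs; have s22 : e22 s = 2%:R - e11 s by rewrite -trs /tr; ring.
have := SL2_det s; rewrite s22 => sd.
have [s21|s21] := eqVneq (e21 s) 0.
  have s11 : e11 s = 1.
    apply/eqP; rewrite -subr_eq0 -sqrf_eq0; apply/eqP.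
    move: sd; rewrite s21 => sd.
    by transitivity (1 - (e11 s * (2%:R - e11 s) - e12 s * 0)); [ring|rewrite sd subrr].
  exists (- e12 s), 1, 0; split; first by rewrite xpair_eqE oner_eq0.
  by apply: SL2_eq; rewrite !tvE ?s21 ?s22 ?s11; ring.
exists (e21 s), ((e11 s - 1) / e21 s), 1; split.
  by rewrite xpair_eqE oner_eq0 andbF.
apply: SL2_eq; rewrite !tvE.
- by field.
- apply: (mulfI s21); have -> : e21 s * e12 s = e11 s * (2%:R - e11 s) - 1.
    by rewrite -[X in _ - X]sd; ring.
  by field.
- by ring.
- by rewrite s22; field.
Qed.

(** The squared factor is the determinant of the two fixed vectors, so a product of two nontrivial
    unipotents has trace 2 exactly when they fix the same line. *)
Lemma tr_tvM k x y k' x' y' :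
  tr (tv k x y * tv k' x' y')%g = 2%:R - k * k' * (x * y' - y * x') ^+ 2.
Proof. by rewrite /tr !SL2E !tvE; ring. Qed.

(** The unipotent groups of two distinct lines meet trivially: a common element times [tv 1 x' y']
    has trace 2, so by [tr_tvM] it is trivial. *)
Lemma tvM_inj x y x' y' k1 k2 l1 l2 : x * y' - y * x' != 0 ->
  (tv k1 x y * tv k2 x' y' = tv l1 x y * tv l2 x' y')%g -> k1 = l1 /\ k2 = l2.
Proof.
move=> d0 E.
have E' : tv (k1 - l1) x y = tv (l2 - k2) x' y'.
  by rewrite addrC !tvD !tvN; apply: (mulgI (tv l1 x y)); rewrite mulKVg mulgA -E mulgK.
have kl1 : k1 = l1.
  have := tr_tvM (k1 - l1) x y 1 x' y'; rewrite E' -tvD tr_tv mulr1.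
  move/eqP; rewrite -subr_eq0 opprD opprK addrA subrr add0r mulf_eq0 sqrf_eq0.
  by rewrite (negPf d0) orbF subr_eq0 => /eqP.
split=> //; move: E; rewrite kl1 => /mulgI; apply: tv_inj.
by apply: contraNneq d0 => -[-> ->]; rewrite !mulr0 subrr.
Qed.

End Geometry.

(** * Products of elements of trace 2 *)

Section Conics.
Variable F : finFieldType.
Hypothesis F2 : (2%:R : F)%R != 0%R.
Local Notation G := (SL2 F).
Local Open Scope ring_scope.
Implicit Types (g h s : G) (x y z k : F).

Lemma trVM s h : tr (s^-1 * h)%g =
  e22 s * e11 h - e12 s * e21 h - e21 s * e12 h + e11 s * e22 h.
Proof. by rewrite /tr !SL2E; ring. Qed.

(** As 2 is invertible, the hypotheses amount to [b (h - 1) = a (g - 1)]. Since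
    [det (s - 1) = 2 - tr s] on SL2, comparing determinants gives [a b (b - a) = 0]; then [b = 0]
    means [g = 1], and [b = a] means [g = h]. *)
Lemma pencil_nondegenerate h g : tr h != 2%:R ->
  let a := tr h - 2%:R in let b := tr g - 2%:R in
  b * (e11 h - e22 h) = a * (e11 g - e22 g) ->
  b * e21 h = a * e21 g -> b * e12 h = a * e12 g -> g = 1%g \/ g = h.
Proof.
move=> trh a b E E21 E12.
have a0 : a != 0 by rewrite subr_eq0.
have E11 : b * (e11 h - 1) = a * (e11 g - 1).
  apply: (mulfI F2); transitivity (b * (e11 h - e22 h) + b * a).
    by rewrite /a /tr; ring.
  by rewrite E /b /tr; ring.
have E22 : b * (e22 h - 1) = a * (e22 g - 1).
  transitivity (b * a - b * (e11 h - 1)); first by rewrite /a /tr; ring.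
  by rewrite E11 /b /tr; ring.
have dets s : tr s - 2%:R = - ((e11 s - 1) * (e22 s - 1) - e12 s * e21 s).
  transitivity (tr s - 1 - (e11 s * e22 s - e12 s * e21 s)); last by rewrite /tr; ring.
  by rewrite SL2_det; ring.
have : a * b * (b - a) == 0.
  apply/eqP; transitivity (- (a ^+ 2 * b) + b ^+ 2 * a); first by ring.
  have bE : b = _ := dets g; have aE : a = _ := dets h.
  transitivity (- (a ^+ 2 * - ((e11 g - 1) * (e22 g - 1) - e12 g * e21 g)) +
    b ^+ 2 * - ((e11 h - 1) * (e22 h - 1) - e12 h * e21 h)); first by rewrite -bE -aE.
  transitivity ((a * (e11 g - 1)) * (a * (e22 g - 1)) - (a * e12 g) * (a * e21 g) -
    ((b * (e11 h - 1)) * (b * (e22 h - 1)) - (b * e12 h) * (b * e21 h))); first by ring.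
  by rewrite E11 E22 E12 E21 subrr.
rewrite !mulf_eq0 (negPf a0) /= [b - a == 0]subr_eq0 => /orP[] /eqP ba.
  left; move: E11 E22 E12 E21; rewrite ba !mul0r => /esym/eqP + /esym/eqP + /esym/eqP + /esym/eqP.
  rewrite !mulf_eq0 (negPf a0) /= !subr_eq0 => /eqP ? /eqP ? /eqP ? /eqP ?.
  by apply: SL2_eq; rewrite !SL2E.
right; move: E11 E22 E12 E21; rewrite ba.
move=> /(mulfI a0)/addIr ? /(mulfI a0)/addIr ? /(mulfI a0) ? /(mulfI a0) ?.
exact: SL2_eq.
Qed.

(* The conditions are a plane through the origin and an affine plane
   in the coordinates [s - 1], intersected with the nilpotent cone. *)
Lemma card_conics h g : tr h != 2%:R -> g != 1%g -> g != h ->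
  (#|[set s : G | [&& tr s == 2%:R, tr (s^-1 * h)%g == 2%:R &
      tr (s^-1 * g)%g == 2%:R]]| <= 3)%N.
Proof.
move=> trh g1 gh; set T := [set s | _].
pose a := tr h - 2%:R; pose b := tr g - 2%:R.
have a0 : a != 0 by rewrite subr_eq0.
(* Coefficients of the plane through the origin: [b] times the affine condition from [h] minus [a]
   times the one from [g], which cancels the constants. *)
pose al := b * (e11 h - e22 h) - a * (e11 g - e22 g).
pose be := b * e21 h - a * e21 g; pose ga := b * e12 h - a * e12 g.
have TP s : s \in T -> [/\ e22 s = 2%:R - e11 s, e12 s * e21 s = - (e11 s - 1) ^+ 2,
    (e11 s - 1) * (e11 h - e22 h) + e12 s * e21 h + e21 s * e12 h = a &
    (e11 s - 1) * al + e12 s * be + e21 s * ga = 0].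
  rewrite inE !trVM => /and3P[/eqP s22' /eqP sh /eqP sg].
  have s22 : e22 s = 2%:R - e11 s by rewrite -s22' /tr; ring.
  have sa : (e11 s - 1) * (e11 h - e22 h) + e12 s * e21 h + e21 s * e12 h = a.
    by rewrite /a -[X in _ = _ - X]sh s22 /tr; ring.
  have sb : (e11 s - 1) * (e11 g - e22 g) + e12 s * e21 g + e21 s * e12 g = b.
    by rewrite /b -[X in _ = _ - X]sg s22 /tr; ring.
  split=> //.
    have := SL2_det s; rewrite s22 => sd.
    transitivity (e11 s * (2%:R - e11 s) - (e11 s * (2%:R - e11 s) - e12 s * e21 s)).
      by ring.
    by rewrite sd; ring.
  transitivity (b * a - a * b); last by rewrite mulrC subrr.
  by rewrite -{1}sa -{2}sb /al /be /ga; ring.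
(* The slope [t] below parametrises the lines of the cone apart from the one where [e21 s = 0]; each
   line holds at most one point of the affine plane, as [a] is nonzero. *)
pose T0 := [set s in T | e21 s == 0]; pose T1 := [set s in T | e21 s != 0].
have cardT : (#|T| <= #|T0| + #|T1|)%N.
  rewrite -(cardsID [set s | e21 s == 0] T) leq_add // subset_leq_card //.
    by apply/subsetP=> s; rewrite !inE.
  by apply/subsetP=> s; rewrite !inE andbC.
have T0_le1 : (#|T0| <= 1)%N.
  apply/card_le1_eqP => s s'; rewrite ![in _ \in T0]inE.
  move=> /andP[/TP[s22 sq sa _] /eqP s21] /andP[/TP[s22' sq' sa' _] /eqP s21'].
  have e11_1 (r : G) : e12 r * e21 r = - (e11 r - 1) ^+ 2 -> e21 r = 0 -> e11 r = 1.
    move=> + r21; rewrite r21 mulr0 => /esym/eqP; rewrite oppr_eq0 sqrf_eq0.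
    by rewrite subr_eq0 => /eqP.
  have s11 := e11_1 _ sq s21; have s11' := e11_1 _ sq' s21'.
  move: sa sa'; rewrite s11 s11' s21 s21' subrr !mul0r !add0r !addr0 => sa sa'.
  have h21 : e21 h != 0 by apply: contraNneq a0 => h0; rewrite -sa h0 mulr0.
  apply: SL2_eq; rewrite ?s22 ?s22' ?s11 ?s11' ?s21 ?s21' //.
  by apply: (mulIf h21); rewrite sa sa'.
apply: (leq_trans cardT); rewrite -[3%N]/(1 + 2)%N; apply: leq_add => //.
pose t s := (e11 s - 1) / e21 s.
have T1P s : s \in T1 -> [/\ e21 s != 0, e11 s = 1 + t s * e21 s,
    e12 s = - (t s ^+ 2 * e21 s), e22 s = 1 - t s * e21 s &
    e21 s * (t s * (e11 h - e22 h) - t s ^+ 2 * e21 h + e12 h) = a /\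
    t s * al - t s ^+ 2 * be + ga = 0].
  rewrite ![in _ \in T1]inE => /andP[/TP[s22 sq sa sb] s21].
  have s11 : e11 s = 1 + t s * e21 s by rewrite /t; field.
  have s12 : e12 s = - (t s ^+ 2 * e21 s).
    by apply: (mulIf s21); rewrite sq s11; ring.
  split=> //; first by rewrite s22 s11; ring.
  split; first by rewrite -sa s11 s12; ring.
  by apply: (mulfI s21); rewrite mulr0 -sb s11 s12; ring.
have t_inj : {in T1 &, injective t}.
  move=> s s' /T1P[s21 s11 s12 s22 [sa _]] /T1P[s21' s11' s12' s22' [sa' _]] tt.
  have e21E : e21 s = e21 s'.
    move: sa' a0; rewrite -tt -sa => sa'.
    by rewrite mulf_eq0 => /norP[_ /mulIf]; apply.
  by apply: SL2_eq; rewrite // ?s11 ?s11' ?s12 ?s12' ?s22 ?s22' tt e21E.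
(* The equation of the plane through the origin in terms of the slope; it is not identically zero by
   [pencil_nondegenerate], so at most two slopes occur. *)
pose P := (- be) *: 'X^2 + al *: 'X + ga%:P : {poly F}.
have P0 : P != 0.
  apply/eqP => PE.
  have := congr1 (fun q : {poly F} => q`_0) PE; have := congr1 (fun q : {poly F} => q`_1) PE.
  have := congr1 (fun q : {poly F} => q`_2) PE.
  rewrite !coefE /= !mulr0 !mulr1 !addr0 !add0r => /eqP; rewrite oppr_eq0.
  move=> /eqP/subr0_eq be0 /subr0_eq al0 /subr0_eq ga0.
  by case: (pencil_nondegenerate trh al0 be0 ga0) => E; [move: g1|move: gh]; rewrite E eqxx.
have szP : (size P <= 3)%N.
  have le_max (p q : {poly F}) : (size p <= 3)%N -> (size q <= 3)%N -> (size (p + q)%R <= 3)%N.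
    by move=> p3 q3; rewrite (leq_trans (size_polyD _ _)) // geq_max p3.
  apply: (le_max); last by rewrite size_polyC; case: (ga != 0).
  by apply: (le_max); rewrite (leq_trans (size_scale_leq _ _)) ?size_polyXn ?size_polyX.
have := @max_poly_roots _ P [seq t s | s <- enum T1] P0.
rewrite size_map -cardE => /(_ _ _)/leq_trans; rewrite -ltnS; apply=> //.
  apply/allP => _ /mapP[s + ->]; rewrite mem_enum => /T1P[_ _ _ _ [_ Pt]].
  by rewrite /root /P !hornerD !hornerZ hornerXn hornerX hornerC; apply/eqP; rewrite -[RHS]Pt; ring.
by rewrite map_inj_in_uniq ?enum_uniq // => s s'; rewrite !mem_enum; apply: t_inj.
Qed.

End Conics.

(** * Counting unipotents that fix a given line *)

Section SymmetricSubsets.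
Variable F : finFieldType.
Local Notation G := (SL2 F).
Variable A : {set G}.
Hypotheses (A1 : 1%g \in A) (AV : (A^-1)%g = A).
Local Open Scope ring_scope.
Implicit Types (g h s : G) (x y z k : F).

Definition line_part m x y : {set F} := [set k | tv k x y \in (A ^+ m)%g].
Definition trace2_part m : {set G} := [set s in (A ^+ m)%g | tr s == 2%:R].

(** Once the line is moved to that of [(1, 0)], centralising elements are unipotents up to sign. The
    sign costs the factor 2; two elements of [A ^ 2] with the same sign differ by a unipotent of
    [A ^ 4] fixing the line. *)
Lemma card_line_part_centralizer k x y : k != 0 -> (x, y) != (0, 0) ->
  (#|((A * A^-1) :&: 'C[tv k x y])%g| <= 2 * #|line_part 4 x y|)%N.
Proof.
move=> k0 xy0; have [g [g11 g21]] := SL2_first_column xy0.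
pose f (z : G) := e11 (g^-1 * z * g)%g.
have tvg l : tv l x y = (g * upper (- l) * g^-1)%g.
  by rewrite /upper opprK tvJ !mulr1 !mulr0 !addr0 g11 g21.
have DP (z : G) : z \in ((A * A^-1) :&: 'C[tv k x y])%g ->
  [/\ z \in (A ^+ 2)%g, e21 (g^-1 * z * g)%g = 0, e22 (g^-1 * z * g)%g = f z
    & (f z == 1) || (f z == -1)].
  rewrite AV in_setI => /andP[zA]; rewrite tvg => zC.
  have zC' : (g^-1 * z * g)%g \in 'C[upper (- k) : G]%g.
    have -> : upper (- k) = ((g * upper (- k) * g^-1) ^ g)%g :> G.
      by rewrite conjgE !mulgA mulVg mul1g mulgKV.
    have -> : (g^-1 * z * g = z ^ g)%g by rewrite conjgE mulgA.
    by rewrite cent1J memJ_conjg.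
  have nk0 : - k != 0 by rewrite oppr_eq0.
  by have [? ? ?] := up_centralizer nk0 zC'; split; rewrite // expgS expg1.
apply: (leq_trans (@leq_card_fiber _ _ f _ #|line_part 4 x y| _)); last first.
  apply: leq_mul => //.
  pose pm : {set F} := [set 1; -1].
  apply: (@leq_trans #|pm|); last by rewrite cards2; case: (_ != _).
  apply/subset_leq_card/subsetP => _ /imsetP[z /DP[_ _ _ +] ->].
  by rewrite !inE.
move=> z0 /[dup] z0D /DP[z0A z021 z022 z0f].
pose u (z : G) := (g^-1 * (z0^-1 * z) * g)%g.
have uP (z : G) : z \in ((A * A^-1) :&: 'C[tv k x y])%g -> f z = f z0 -> u z = upper (e12 (u z)).
  move=> /DP[_ z21 z22 zf] fz.
  have uE : u z = ((g^-1 * z0 * g)^-1 * (g^-1 * z * g))%g.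
    by rewrite /u !invMg invgK !mulgA mulgK.
  have f2 : f z0 * f z0 = 1 by case/orP: z0f => /eqP ->; ring.
  have E11 : e11 (g^-1 * z * g)%g = f z by [].
  have E11' : e11 (g^-1 * z0 * g)%g = f z0 by [].
  apply: upP; rewrite uE; move: (g^-1 * z * g)%g (g^-1 * z0 * g)%g z21 z22 z021 z022 E11 E11' => w w0.
  - by move=> w21 w22 w021 w022 E11 E11'; rewrite !SL2E w21 w021; ring.
  - by move=> w21 w22 w021 w022 E11 E11'; rewrite !SL2E w21 w22 w021 w022 E11 E11' fz; ring.
  - by move=> w21 w22 w021 w022 E11 E11'; rewrite !SL2E w21 w022 E11 fz f2; ring.
apply: (@leq_card_inj _ _ (fun z : G => - e12 (u z)) [set y in _ | f y == f z0] (line_part 4 x y)) => [z|z z'].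
  rewrite inE => /andP[zD /eqP fz]; rewrite inE tvg opprK -(uP z) //.
  have -> : (g * u z * g^-1 = z0^-1 * z)%g by rewrite /u !mulgA mulgV mul1g mulgK.
  by apply: (@expX_mul _ _ 2 2); [apply: expX_inv|case/DP: zD].
move=> /setIdP[zD /eqP fz] /setIdP[zD' /eqP fz'] /oppr_inj uu.
have : u z = u z' by rewrite (uP z zD fz) uu -(uP z' zD' fz').
by move=> /mulIg /mulgI /mulgI.
Qed.

(** Orbit-stabiliser for a nontrivial unipotent: its conjugates by [A] have trace 2 and lie in
    [A ^ m.+2]. *)
Lemma leq_card_line_part m k x y : k != 0 -> (x, y) != (0, 0) ->
  tv k x y \in (A ^+ m)%g ->
  (#|A| <= 2 * #|line_part 4 x y| * #|trace2_part m.+2|)%N.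
Proof.
move=> k0 xy0 kA; rewrite mulnC.
apply: leq_trans (leq_card_conj_class A (tv k x y)) _.
apply: leq_mul; last exact: card_line_part_centralizer.
apply/subset_leq_card/subsetP => _ /imsetP[a aA ->]; rewrite inE.
have -> : m.+2 = (1 + m + 1)%N by rewrite add1n addn1.
rewrite expX_conj ?expg1 //=.
by rewrite conjgE mulgA -{2}(invgK a) tr_conj tr_tv.
Qed.

(** One of the two generators moves the line. Conjugating by it, at a cost of two letters, gives as
    many unipotents on another line, and products across the two lines are distinct by [tvM_inj]. *)
Lemma card_line_part_sqr m x y c : (x, y) != (0, 0) -> c != 0 ->
  upper 1 \in A -> lower c \in A ->
  (#|line_part m x y| ^ 2 <= #|(A ^+ (2 * m + 2))%g|)%N.
Proof.
move=> xy0 c0 uA lA.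
have [a aA [x' [y' [d0 aJ]]]] : exists2 a, a \in A & exists x' y',
    x * y' - y * x' != 0 /\ forall k, (a * tv k x y * a^-1)%g = tv k x' y'.
  have [y0|y0] := eqVneq y 0.
    exists (lower c) => //; exists x, (c * x + y); split=> [|k]; last first.
      by rewrite tvJ !upE; congr tv; ring.
    rewrite y0; have x0 : x != 0 by apply: contraNneq xy0 => ->; rewrite y0.
    by have -> : x * (c * x + 0) - 0 * x = c * (x * x); rewrite ?mulf_neq0 //; ring.
  exists (upper 1) => //; exists (x + y), y; split=> [|k]; last first.
    by rewrite tvJ !upE; congr tv; ring.
  by have -> : x * y - y * (x + y) = - (y * y); rewrite ?oppr_eq0 ?mulf_neq0 //; ring.
rewrite -mulnn -cardsX.
apply: (@leq_card_inj _ _ (fun kl => tv kl.1 x y * (tv kl.2 x' y'))%g) => [[k l]|[k l] [k' l'] _ _ /=].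
  rewrite !inE /= => /andP[kA lA'].
  have -> : (2 * m + 2 = m + (1 + m + 1))%N by lia.
  rewrite expX_mul // -aJ; apply: expX_mul; last by rewrite expg1 -AV memV_invg.
  by apply: expX_mul => //; rewrite expg1.
by move=> /(tvM_inj d0)[-> ->].
Qed.

End SymmetricSubsets.

Section Trace2.
Variable F : finFieldType.
Hypothesis F2 : (2%:R : F)%R != 0%R.
Local Notation G := (SL2 F).
Variables (A : {set G}) (c : F).
Hypotheses (A1 : 1%g \in A) (AV : (A^-1)%g = A).
Hypotheses (c0 : c != 0%R) (upA : upper 1%R \in A) (loA : lower c \in A).
Local Open Scope ring_scope.
Implicit Types (g h s : G) (x y z k : F).

(** Consider products [s * t] of two elements of the conic. Over a value [g] other than 1 and [h],
    the factor [s] lies on the conics of both [h] and [g], leaving 3 choices; over [g = 1] or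
    [g = h], [s] determines [t]. *)
Lemma card_conic_sqr m h : tr h != 2%:R ->
  (#|[set s in trace2_part A m | tr (s^-1 * h)%g == 2%:R]| ^ 2 <= 9 * #|(A ^+ (2 * m))%g|)%N.
Proof.
move=> trh; set Fh := [set s in _ | _]; set b := #|(A ^+ (2 * m))%g|.
have b0 : (0 < b)%N by apply/card_gt0P; exists 1%g; apply: expX_one.
pose P := setX Fh Fh.
pose bad (q : G * G) := ((q.1 * q.2)%g == 1%g) || ((q.1 * q.2)%g == h).
have Pbad : (#|P :&: [set q | bad q]| <= #|Fh| * 2)%N.
  apply: leq_trans (@leq_card_fiber _ _ (fun q : G * G => q.1) (P :&: [set q | bad q]) 2 _) _; last first.
    rewrite leq_mul2r /=; apply/subset_leq_card/subsetP => _ /imsetP[[s t] + ->].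
    by rewrite in_setI in_setX => /andP[/andP[]].
  move=> [s t] _ /=; apply: leq_trans (_ : #|[set (s^-1)%g; (s^-1 * h)%g]| <= 2)%N; last first.
    by rewrite cards2; case: (_ != _).
  apply: (@leq_card_inj _ _ (fun q : G * G => q.2)) => [[s' t']|[s' t'] [s'' t'']] /=.
    rewrite !inE /bad /= => /andP[/andP[_ b'] /eqP ss']; rewrite ss' in b'.
    by rewrite -[t'](mulKg s); case/orP: b' => /eqP ->; rewrite ?mulg1 eqxx ?orbT.
  by move=> /setIdP[_ /eqP /= ->] /setIdP[_ /eqP /= ->] ->.
have Pgood : (#|P :\: [set q | bad q]| <= b * 3)%N.
  apply: leq_trans (@leq_card_fiber _ _ (fun q : G * G => (q.1 * q.2)%g) (P :\: [set q | bad q]) 3 _) _; last first.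
    rewrite leq_mul2r /=; apply/subset_leq_card/subsetP => _ /imsetP[[s t] + ->].
    rewrite in_setD in_setX => /andP[_ /andP[/setIdP[/setIdP[sA _] _] /setIdP[/setIdP[tA _] _]]].
    by rewrite mul2n -addnn expX_mul.
  move=> [s t] /setDP[_]; rewrite inE /bad /= => /norP[st1 sth].
  apply: leq_trans (card_conics F2 trh st1 sth).
  apply: (@leq_card_inj _ _ (fun q : G * G => q.1)) => [[s' t']|[s' t'] [s'' t'']] /=.
    case/setIdP => /setDP[+ _] /= /eqP <-; rewrite in_setX !inE /= mulKg.
    by move=> /andP[/andP[/andP[_ ->] ->] /andP[/andP[_ ->] _]].
  by move=> /setIdP[_ /eqP /= <-] /setIdP[_ /eqP /= +] ss; rewrite ss => /mulgI ->.
have : (#|Fh| ^ 2 <= 2 * #|Fh| + 3 * b)%N.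
  by rewrite -mulnn -cardsX -/P -(cardsID [set q | bad q] P) leq_add // mulnC.
by move: #|Fh| b0; clear; nia.
Qed.

(** Count pairs [(s, t)] of elements of trace 2. If [s * t] has another trace, [s] lies on the conic
    of that product; if it has trace 2, then [s = 1] or [t] fixes the line of [s]. In each case few
    pairs remain. *)
Lemma card_trace2_part m :
  (#|trace2_part A m| ^ 4 <= 81 * #|(A ^+ (2 * m + 2))%g| ^ 3)%N.
Proof.
set S := trace2_part A m; set b := #|(A ^+ (2 * m + 2))%g|.
have b0 : (0 < b)%N by apply/card_gt0P; exists 1%g; apply: expX_one.
have Ab (k : nat) : (k <= 2 * m + 2)%N -> (#|(A ^+ k)%g| <= b)%N.
  by move=> km; apply/subset_leq_card/expX_sub.
have Sb : (#|S| <= b)%N.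
  apply: leq_trans (Ab m _); last by lia.
  by apply/subset_leq_card/subsetP => s; rewrite inE => /andP[].
(* The integer square root of [9 * b], a common bound for conics and for unipotents on one line. *)
have [f [f2 fP]] : exists f, (f ^ 2 <= 9 * b)%N /\ forall n, (n ^ 2 <= 9 * b)%N -> (n <= f)%N.
  have ex0 : exists n, (n ^ 2 <= 9 * b)%N by exists 0%N.
  have bd n : (n ^ 2 <= 9 * b)%N -> (n <= 9 * b)%N by clear; nia.
  by case: (ex_maxnP ex0 bd) => f ? ?; exists f.
have f1 : (0 < f)%N by apply: fP; lia.
pose P := setX S S.
pose P1 := P :&: [set q : G * G | tr (q.1 * q.2)%g == 2%:R].
have P1_1 : (#|P1 :&: [set q | q.1 == 1%g]| <= #|S|)%N.
  apply: (@leq_card_inj _ _ (fun q : G * G => q.2)) => [[s t]|[s t] [s' t']] /=.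
    by rewrite !in_setI in_setX => /andP[/andP[/andP[]]].
  by move=> /setIP[_]; rewrite inE /= => /eqP -> /setIP[_]; rewrite inE /= => /eqP -> ->.
have P1_2 : (#|P1 :\: [set q | q.1 == 1%g]| <= #|S| * f)%N.
  apply: leq_trans (@leq_card_fiber _ _ (fun q : G * G => q.1) (P1 :\: [set q | q.1 == 1%g]) f _) _; last first.
    rewrite leq_mul2r; apply/orP; right.
    apply/subset_leq_card/subsetP => _ /imsetP[[s t] + ->].
    by rewrite in_setD in_setI in_setX => /andP[_ /andP[/andP[]]].
  move=> [s t] /setDP[/setIP[/setXP[/setIdP[_ /eqP trs] _] _]]; rewrite inE /= => s1.
  have [k [x [y [xy0 sE]]]] := tr2P trs.
  have k0 : k != 0 by apply: contraNneq s1 => k0; rewrite sE k0 tv0.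
  apply: leq_trans (fP #|line_part A m x y| _); last first.
    apply: leq_trans (card_line_part_sqr A1 AV m xy0 c0 upA loA) _.
    by rewrite -/b; lia.
  (* The parameter of the second factor relative to the vector [(x, y)] of [s], read off an entry in
     which that vector does not vanish. *)
  pose nc (q : G * G) : F := if x == 0 then e21 q.2 / y ^+ 2 else - e12 q.2 / x ^+ 2.
  have ncE q : q \in [set q0 in P1 :\: [set q1 | q1.1 == 1%g] | q0.1 == s] ->
      q.1 = s /\ q.2 = tv (nc q) x y /\ q.2 \in (A ^+ m)%g.
    case: q => s' t'; case/setIdP => /setDP[/setIP[/setXP[_ /setIdP[/= tA /eqP trt]]]].
    rewrite inE /= => /eqP tr2 _ /eqP s's; split=> //; split=> //.
    have [k' [x' [y' [xy0' tE]]]] := tr2P trt.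
    have k'd : k' * (x * y' - y * x') = 0.
      move: tr2; rewrite s's sE tE tr_tvM => /eqP; rewrite -subr_eq0 addrAC subrr add0r oppr_eq0.
      by rewrite -mulrA mulf_eq0 (negPf k0) /= mulf_eq0 sqrf_eq0 -mulf_eq0 => /eqP.
    rewrite /= /nc /= tE; case: (eqVneq x 0) => x0.
      have y0 : y != 0 by apply: contraNneq xy0 => ->; rewrite x0.
      have k'x' : k' * x' = 0.
        by apply: (mulfI y0); rewrite mulr0 -oppr0 -k'd x0; ring.
      apply: SL2_eq; rewrite !tvE ?x0.
      - by rewrite k'x'; ring.
      - by rewrite expr2 mulrA k'x'; ring.
      - by field.
      - by rewrite k'x'; ring.
    have k'y' : k' * y' = y * (k' * x') / x.
      by apply: (mulIf x0); rewrite mulfVK //; apply/eqP; rewrite -subr_eq0 -k'd; apply/eqP; ring.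
    apply: SL2_eq; rewrite !tvE.
    - by rewrite -mulrA [x' * y']mulrC mulrA k'y'; field.
    - by field.
    - transitivity (y * x' * (k' * y') / x); last by rewrite k'y'; field.
      by transitivity (k' * y' * y'); [|rewrite [in LHS]k'y']; field.
    - by rewrite -mulrA [x' * y']mulrC mulrA k'y'; field.
  apply: (@leq_card_inj _ _ nc) => [q /ncE[_ [qE qA]]|q q' /ncE[qs [qE _]] /ncE[qs' [qE' _]] qq].
    by rewrite inE -qE.
  by rewrite (surjective_pairing q) (surjective_pairing q') qs qs' qE qE' qq.
have P2 : (#|P :\: [set q : G * G | tr (q.1 * q.2)%g == 2%:R]| <= b * f)%N.
  set D := _ :\: _.
  apply: leq_trans (@leq_card_fiber _ _ (fun q : G * G => (q.1 * q.2)%g) D f _) _; last first.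
    rewrite leq_mul2r; apply/orP; right; apply: leq_trans (Ab (m + m)%N _); last by lia.
    apply/subset_leq_card/subsetP => _ /imsetP[[s t] + ->].
    by move=> /setDP[/setXP[/setIdP[sA _] /setIdP[tA _]] _]; apply: expX_mul.
  move=> [s t] /setDP[_]; rewrite inE /= => trst.
  apply: leq_trans (fP _ _); last first.
    apply: leq_trans (card_conic_sqr m trst) _.
    by rewrite leq_mul2l /=; apply: Ab; lia.
  apply: (@leq_card_inj _ _ (fun q : G * G => q.1)) => [[s' t']|[s' t'] [s'' t'']] /=.
    case/setIdP => /setDP[/setXP[/= sS' /setIdP[_ trt]] _] /= /eqP <-.
    by rewrite inE sS' mulKg.
  by move=> /setIdP[_ /eqP /= <-] /setIdP[_ /eqP /= +] ss; rewrite ss => /mulgI ->.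
have M2 : (#|S| ^ 2 <= 3 * (b * f))%N.
  rewrite -mulnn -cardsX -/P -(cardsID [set q : G * G | tr (q.1 * q.2)%g == 2%:R] P).
  rewrite -/P1 -(cardsID [set q | q.1 == 1%g] P1).
  have Sbf : (#|S| * f <= b * f)%N by rewrite leq_mul2r Sb orbT.
  have Sf : (#|S| <= #|S| * f)%N by rewrite leq_pmulr.
  apply: leq_trans (leq_add (leq_add P1_1 P1_2) P2) _.
  by move: Sbf Sf; move: (#|S|)%N (#|S| * f)%N (b * f)%N => u v w; lia.
have : (#|S| ^ 4 <= (3 * (b * f)) ^ 2)%N by rewrite -[4%N]/(2 * 2)%N expnM leq_exp2r.
move/leq_trans; apply; have := leq_mul (leqnn (9 * b ^ 2)) f2.
rewrite !expnS !expn0 !muln1. by move: (b) (f) => u v; clear; lia.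
Qed.

End Trace2.

Lemma leq_sum_card_fibers (I T : finType) (D : {set I * T}) (n : nat) :
  (forall i, n <= #|[set t | (i, t) \in D]|) -> #|I| * n <= #|D|.
Proof.
move=> nD; rewrite -sum1_card (partition_big (fun q : I * T => q.1) predT) //=.
rewrite -sum_nat_const; apply: leq_sum => i _; apply: leq_trans (nD i) _.
rewrite sum1dep_card; apply: (@leq_card_inj _ _ (fun t => (i, t))) => [t|t t' _ _ [->] //].
by rewrite !inE /= => ->; rewrite eqxx.
Qed.

(** * Spreading unipotents over all lines *)

Section Unipotents.
Variable F : finFieldType.
Local Notation G := (SL2 F).
Variables (A : {set G}) (c : F).
Hypotheses (A1 : 1%g \in A) (AV : (A^-1)%g = A).
Hypotheses (c0 : c != 0%R) (upA : upper 1%R \in A) (loA : lower c \in A).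
Local Open Scope ring_scope.
Implicit Types (g h s : G) (x y z k : F).

Definition up_part m : {set F} := [set x | upper x \in (A ^+ m)%g].
Definition borel_part m : {set G} := [set h in (A ^+ m)%g | e21 h == 0].
(** Squares appear because conjugation by an upper triangular [h] multiplies the entry of [upper x]
    by [e11 h ^ 2]. *)
Definition mult_part m : {set F} := [set e11 h ^+ 2 | h in borel_part m].

Lemma card_line_part_up m : #|line_part A m 1 0| = #|up_part m|.
Proof.
apply/eqP; rewrite eqn_leq; apply/andP; split;
  apply: (@leq_card_inj _ _ -%R) => [k|k l _ _ /oppr_inj //]; rewrite !inE /upper ?opprK //.
Qed.

(** The vectors [(1 + j c, c)] arise from [(1, 0)] by [lower c] and then [j] times [upper 1]. The
    hypothesis provides a nontrivial unipotent of [A ^ 4] on each line; its conjugate in [A ^ 6]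
    fixes the next line, and orbit-stabiliser returns to [A ^ 4], so nothing is lost along the
    induction. *)
Lemma card_line_part_orbit : (2 * #|trace2_part A 8| < #|A|)%N ->
  (#|A| <= 2 * #|up_part 4| * #|trace2_part A 8|)%N /\
  forall j : nat, (#|A| <= 2 * #|line_part A 4 (1 + j%:R * c)%R c| * #|trace2_part A 8|)%N.
Proof.
move=> S8; split.
  rewrite -card_line_part_up; apply: (leq_card_line_part AV (m := 6) (k := - 1)).
  - by rewrite oppr_eq0 oner_eq0.
  - by rewrite xpair_eqE oner_eq0.
  - by apply: (@expX_le _ _ A1 1) => //; rewrite expg1.
have step k x y : k != 0 -> (x, y) != (0, 0) -> tv k x y \in (A ^+ 6)%g ->
    (#|A| <= 2 * #|line_part A 4 x y| * #|trace2_part A 8|)%N.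
  exact: (leq_card_line_part AV (m := 6)).
have vj0 (j : nat) : (1 + j%:R * c, c) != (0, 0).
  by rewrite xpair_eqE (negPf c0) andbF.
elim=> [|j IHj].
  apply: (step (- 1)) => //; first by rewrite oppr_eq0 oner_eq0.
  have -> : tv (- 1) (1 + 0%:R * c) c = (lower c * upper 1%R * (lower c)^-1)%g.
    by rewrite /upper tvJ !upE; congr tv; ring.
  apply: (@expX_le _ _ A1 (1 + 1 + 1)) => //.
  apply: expX_mul; last by apply: (expX_inv AV); rewrite expg1.
  by apply: expX_mul; rewrite expg1.
have [k kl k0] : exists2 k, k \in line_part A 4 (1 + j%:R * c) c & k != 0.
  have : (1 < #|line_part A 4 (1 + j%:R * c)%R c|)%N.
    rewrite ltnNge; apply: contraL S8; rewrite -leqNgt => l1.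
    by apply: leq_trans IHj _; apply: leq_mul => //; move: l1; move: #|_| => u; lia.
  rewrite (cardsD1 0) => l1.
  have /card_gt0P[k] : (0 < #|line_part A 4 (1 + j%:R * c)%R c :\ 0%R|)%N.
    by move: l1; case: (0 \in _) => //; move: #|_| => n; lia.
  by rewrite in_setD1 => /andP[k0 kl]; exists k.
apply: (step k) => //.
have -> : tv k (1 + j.+1%:R * c) c = (upper 1%R * tv k (1 + j%:R * c)%R c * (upper 1%R)^-1)%g.
  by rewrite tvJ !upE; congr tv; rewrite -?natr1; ring.
apply: (@expX_le _ _ A1 (1 + 4 + 1)) => //.
apply: expX_mul; last by apply: (expX_inv AV); rewrite expg1.
by apply: expX_mul; rewrite ?expg1 //; rewrite inE in kl.
Qed.

(** In [tv k x c * upper y] the entry [e21] gives [k], then [e11] gives [x], then [y] is determined.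
    The predecessor discards [k = 0], for which [x] is invisible. *)
Lemma card_unipotent_products n : (forall x, (n <= #|line_part A 4 x c|)%N) ->
  (#|F| * (n.-1 * #|up_part 4|) <= #|(A ^+ 8)%g|)%N.
Proof.
move=> nl; pose D := [set q : F * (F * F) |
  (q.2.1 \in line_part A 4 q.1 c :\ 0) && (q.2.2 \in up_part 4)].
apply: (@leq_trans #|D|).
  apply: leq_sum_card_fibers => x.
  apply: (@leq_trans #|setX (line_part A 4 x c :\ 0) (up_part 4)|).
    rewrite cardsX leq_mul2r; apply/orP; right.
    have := nl x; rewrite (cardsD1 0); move: #|_ :\ _| => u; clear.
    by case: (_ \in _) => /=; lia.
  by apply/subset_leq_card/subsetP => -[k y]; rewrite in_setX => kyD; rewrite !inE in kyD *.
apply: (@leq_card_inj _ _ (fun q : F * (F * F) => (tv q.2.1 q.1 c * upper q.2.2)%g)).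
  move=> [x [k y]]; rewrite inE /= => /andP[/setD1P[_ kl] yu].
  by rewrite inE in kl; rewrite inE in yu; apply: (@expX_mul _ _ 4 4).
move=> [x [k y]] [x' [k' y']]; rewrite !inE /= => /andP[/andP[k0 _] _] /andP[/andP[k0' _] _] E.
have Ek : k = k'.
  have := congr1 (@e21 F) E; rewrite !SL2E !upE !tvE !mulr1 !mulr0 !addr0.
  by move=> /(mulIf (expf_neq0 2 c0)).
rewrite -Ek in E *.
have Ex : x = x'.
  have := congr1 (@e11 F) E; rewrite !SL2E !upE !tvE !mulr1 !mulr0 !addr0.
  by move=> /addrI /(mulIf c0) /(mulfI k0).
by move: E; rewrite -Ex => /mulgI /up_inj ->.
Qed.

(** Pigeonhole on the projective line: [f g] is the image under [g] of the line of [(1, 0)], with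
    [None] for that line itself, and two elements with equal image differ by an upper triangular
    one. *)
Lemma leq_card_borel m : (#|(A ^+ m)%g| <= #|F|.+1 * #|borel_part (2 * m)|)%N.
Proof.
pose f (g : G) : option F := if e21 g == 0 then None else Some (e11 g / e21 g).
apply: (@leq_trans (#|f @: (A ^+ m)%g| * #|borel_part (2 * m)|)); last first.
  by rewrite leq_mul2r -card_option max_card orbT.
apply: leq_card_fiber => g gA.
apply: (@leq_card_inj _ _ (fun h => (g^-1 * h)%g)) => [h|h h' _ _ /mulgI //].
rewrite inE => /andP[hA /eqP fhg]; rewrite inE mul2n -addnn expX_mul ?expX_inv //=.
move: fhg; rewrite /f !SL2E.
have [h0|h0] := eqVneq (e21 h) 0; have [g0|g0] := eqVneq (e21 g) 0 => //.
  by rewrite h0 g0 => _; apply/eqP; ring.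
move=> [E]; apply/eqP; have -> : e11 h = e11 g / e21 g * e21 h by rewrite -E divfK.
by field.
Qed.

(** Upper triangular elements with the same [e11] differ by an upper unipotent; squaring [e11] costs
    the factor 2. *)
Lemma leq_card_mult m : (#|borel_part m| <= 2 * #|mult_part m| * #|up_part (2 * m)|)%N.
Proof.
apply: (@leq_trans (#|(@e11 F) @: borel_part m| * #|up_part (2 * m)|)%N).
  apply: leq_card_fiber => g gB.
  have := gB; rewrite inE => /andP[gA /eqP g21].
  have uP h : h \in [set h in borel_part m | e11 h == e11 g] ->
      (g^-1 * h)%g = upper (e12 (g^-1 * h)%g).
    move=> /setIdP[/setIdP[hA /eqP h21] /eqP hg].
    have := SL2_det h; have := SL2_det g; rewrite h21 g21 !mulr0 !subr0 hg => gd hd.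
    have g0 : e11 g != 0 by apply: contra_eq_neq gd => ->; rewrite mul0r eq_sym oner_eq0.
    have hg22 : e22 h = e22 g by apply: (mulfI g0); rewrite hd gd.
    apply: upP.
    - by rewrite !SL2E h21 g21; ring.
    - by rewrite !SL2E h21 g21 hg22 hg; ring.
    - by rewrite !SL2E h21 hg mulr0 addr0 mulrC gd.
  apply: (@leq_card_inj _ _ (fun h => e12 (g^-1 * h)%g)) => [h hD|h h' hD hD' hh].
    rewrite inE -uP //; move: hD => /setIdP[/setIdP[hA _] _].
    by rewrite mul2n -addnn expX_mul ?expX_inv.
  by apply: (mulgI (g^-1)%g); rewrite (uP h hD) (uP h' hD') hh.
rewrite leq_mul2r; apply/orP; right.
rewrite mulnC; pose sq (x : F) := x ^+ 2.
have -> : mult_part m = sq @: ((@e11 F) @: borel_part m).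
  by rewrite -imset_comp.
apply: leq_card_fiber => x _.
apply: (@leq_trans #|[set x; - x]|); last by rewrite cards2; case: (_ != _).
apply/subset_leq_card/subsetP => y; rewrite inE => /andP[_].
by rewrite /sq eqf_sqr !inE.
Qed.

Lemma leq_card_mult_up m :
  (#|(A ^+ m)%g| <= 2 * #|F|.+1 * (#|up_part (4 * m)| * #|mult_part (2 * m)|))%N.
Proof.
apply: leq_trans (leq_card_borel m) _.
have := leq_card_mult (2 * m); rewrite (_ : 2 * (2 * m) = 4 * m)%N; last by clear; lia.
move=> /(leq_mul (leqnn #|F|.+1)) /leq_trans; apply.
by rewrite mulnA [(2 * _)%N]mulnC -!mulnA [(#|mult_part _| * _)%N]mulnC; clear; lia.
Qed.

(** Map [(x, y, z)] to [u(x) l(c) u(y) l(c) u(z)]. Its entry [e21] is [c (2 + c y)] and gives [y];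
    when it is nonzero, [e11] and [e22] give [x] and [z]. Hence [y = - 2 / c] is excluded. *)
Lemma card_up_part_cube m :
  (#|up_part m| * (#|up_part m|.-1 * #|up_part m|) <= #|(A ^+ (3 * m + 2))%g|)%N.
Proof.
pose R := up_part m; pose R' := R :\ (- (2%:R / c)).
have R'R : (#|R|.-1 <= #|R'|)%N.
  have := cardsD1 (- (2%:R / c)) R; rewrite -/R'; move: #|R| #|R'| (_ \in R) => u v b ->.
  by case: b; clear; lia.
apply: (@leq_trans #|setX R (setX R' R)|).
  by rewrite !cardsX leq_mul2l leq_mul2r R'R !orbT.
apply: (@leq_card_inj _ _ (fun q : F * (F * F) =>
    (upper q.1 * (lower c * upper q.2.1 * lower c) * upper q.2.2)%g)).
  move=> [x [y z]]; rewrite !in_setX /= => /andP[xR /andP[/setD1P[_ yR] zR]].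
  rewrite !inE in xR yR zR.
  have -> : (3 * m + 2 = m + (1 + m + 1) + m)%N by clear; lia.
  do 3!(apply: expX_mul => //); rewrite ?expg1 //.
  by apply: expX_mul; rewrite ?expg1.
move=> [x [y z]] [x' [y' z']]; rewrite !in_setX /=.
move=> /andP[_ /andP[/setD1P[y0 _] _]] _ E.
have d0 : c * (2%:R + c * y) != 0.
  rewrite mulf_neq0 //; apply: contra_neq y0 => cy.
  by apply: (mulfI c0); apply: (addrI 2%:R); rewrite cy; field.
have E21 := congr1 (@e21 F) E; have E11 := congr1 (@e11 F) E.
have E22 := congr1 (@e22 F) E; move: E21 E11 E22; rewrite !SL2E !upE => E21 E11 E22.
have Ey : y = y'.
  apply: (mulfI c0); apply: (mulfI c0); apply: (addrI (c + c)).
  by move/eqP: E21; rewrite -subr_eq0 => /eqP E21; apply/eqP; rewrite -subr_eq0 -E21; apply/eqP; ring.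
move: E11 E22; rewrite -Ey => /eqP E11 /eqP E22.
have Ex : x = x'.
  apply: (mulIf d0); apply/eqP; rewrite -subr_eq0.
  by move: E11; rewrite -subr_eq0 => /eqP <-; apply/eqP; ring.
have Ez : z = z'.
  apply: (mulIf d0); apply/eqP; rewrite -subr_eq0.
  by move: E22; rewrite -subr_eq0 => /eqP <-; apply/eqP; ring.
by rewrite Ex Ez.
Qed.

End Unipotents.

(** * Sum-product *)

Lemma sum_sqr_leq (I : finType) (P : {set I}) (r : I -> nat) :
  (\sum_(i in P) r i) ^ 2 <= #|P| * \sum_(i in P) r i ^ 2.
Proof.
rewrite -(leq_pmul2l (ltn0Sn 1)).
have -> : 2 * (\sum_(i in P) r i) ^ 2 = \sum_(i in P) \sum_(j in P) 2 * (r i * r j).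
  rewrite -mulnn big_distrl big_distrr /=; apply: eq_bigr => i _.
  by rewrite big_distrr big_distrr.
have -> : 2 * (#|P| * \sum_(i in P) r i ^ 2) =
    \sum_(i in P) \sum_(j in P) (r i ^ 2 + r j ^ 2).
  under [RHS]eq_bigr => i _ do rewrite big_split /= sum_nat_const.
  by rewrite big_split /= sum_nat_const -big_distrr /= addnn mul2n.
by apply: leq_sum => i _; apply: leq_sum => j _; apply: nat_Cauchy.
Qed.

(** Cauchy-Schwarz applied to the sizes of the fibres of [f]. *)
Lemma card_collisions (aT rT : finType) (f : aT -> rT) (D : {set aT}) :
  #|D| ^ 2 <= #|f @: D| * #|[set q in setX D D | f q.1 == f q.2]|.
Proof.
set Q := [set q in _ | _].
have -> : #|D| = \sum_(w in f @: D) #|[set x in D | f x == w]|.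
  rewrite -sum1_card (partition_big_imset f) /=; apply: eq_bigr => w _.
  by rewrite sum1dep_card.
have -> : #|Q| = \sum_(w in f @: D) #|[set x in D | f x == w]| ^ 2.
  rewrite -sum1_card (partition_big (fun q => f q.1) (mem (f @: D))) /=; last first.
    by move=> [a b]; rewrite inE in_setX => /andP[/andP[aD _] _]; apply: imset_f.
  apply: eq_bigr => w _; rewrite sum1dep_card -mulnn -cardsX; apply: eq_card => -[a b].
  rewrite !inE /=; case: (a \in D); case: (b \in D); rewrite ?andbF //=.
  by apply/andP/andP => -[/eqP <- /eqP <-]; rewrite !eqxx.
exact: sum_sqr_leq.
Qed.

Section SumProduct.
Variable p : nat.
Hypothesis p_pr : prime p.
Local Notation F := ('F_p).
Local Open Scope ring_scope.
Variables Y L : {set F}.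
Hypotheses (Y0 : 0 \in Y) (Y1 : 1 \in Y) (L_gt0 : (0 < #|L|)%N).
Hypothesis L0 : forall l, l \in L -> l != 0.
Implicit Types (x y l w : F).

Let f x (q : F * F) : F := q.1 + x * q.2.
Let W x : {set F} := f x @: setX Y L.

(** The difference quotients [(Y - Y) / (L - L)], written without division. *)
Definition quotient_ratio x : bool := [exists q : (F * F) * (F * F),
  [&& q.1.1 \in Y, q.1.2 \in Y, q.2.1 \in L, q.2.2 \in L,
      q.2.1 != q.2.2 & q.1.1 - q.1.2 == x * (q.2.1 - q.2.2)]].

(** A coincidence [y + x l = y' + x l'] with distinct [l], [l'] would exhibit [x] as a difference
    quotient. *)
Lemma card_sumset_notin x : ~~ quotient_ratio x -> #|W x| = (#|Y| * #|L|)%N.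
Proof.
move=> xQ; rewrite /W card_in_imset ?cardsX // => -[y l] [y' l'].
rewrite !in_setX /f /= => /andP[yY lL] /andP[yY' lL'] E.
have [ll'|ll'] := eqVneq l l'; first by move: E; rewrite ll' => /addIr ->.
case/negP: xQ; apply/existsP; exists ((y, y'), (l', l)).
rewrite yY yY' lL lL' eq_sym ll' /=; apply/eqP.
by apply: (addIr (y' + x * l)); transitivity (y + x * l); [|rewrite E]; ring.
Qed.

(** Two distinct pairs [(y, l)] collide for at most one [x], so with [z = |Y| |L|] the collisions
    over all [x] number at most [p z + z ^ 2]. The [x] with fewest collisions works by
    Cauchy-Schwarz. *)
Lemma exists_large_sumset : exists x, (minn (#|Y| * #|L|) p <= 2 * #|W x|)%N.
Proof.
pose E x := #|[set q in setX (setX Y L) (setX Y L) | f x q.1 == f x q.2]|.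
pose T := [set q : F * ((F * F) * (F * F)) |
  (q.2 \in setX (setX Y L) (setX Y L)) && (f q.1 q.2.1 == f q.1 q.2.2)].
have [x xmin] : exists x, forall x', (E x <= E x')%N.
  have [x _ xP] := @arg_minnP F 0 xpredT E isT.
  by exists x => x'; apply: xP.
have pT : (p * E x <= #|T|)%N.
  rewrite -[X in (X * _ <= _)%N](card_Fp p_pr); apply: leq_sum_card_fibers => x'.
  apply: leq_trans (xmin x') _; apply/subset_leq_card/subsetP => q.
  by move=> /setIdP[qD fq]; rewrite !inE in qD *; rewrite qD.
set z := (#|Y| * #|L|)%N.
have T1 : (#|T :&: [set q | q.2.1 == q.2.2]| <= p * z)%N.
  rewrite /z -cardsX -[X in (_ <= X * _)%N](card_Fp p_pr) -cardsT -cardsX.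
  apply: (@leq_card_inj _ _ (fun q => (q.1, q.2.1))) => [[x' [a b]]|[x' [a b]] [y' [a' b']]].
    by rewrite in_setI [_ \in T]inE /= in_setX => /andP[/andP[/andP[aD _] _] _]; rewrite in_setX aD inE.
  by rewrite !in_setI => /andP[_]; rewrite inE /= => /eqP <- /andP[_]; rewrite inE /= => /eqP <- [-> ->].
have T2 : (#|T :\: [set q | q.2.1 == q.2.2]| <= z * z)%N.
  rewrite /z -!cardsX.
  apply: (@leq_card_inj _ _ (fun q => q.2)) => [[x' [a b]]|].
    by rewrite in_setD [_ \in T]inE /= => /andP[_ /andP[]].
  move=> [x1 [[y l] [y' l']]] [x2 q] /= /setDP[+ ab] /setDP[+ _] qE; rewrite -{}qE.
  rewrite !inE /f /= in ab * => /andP[_ /eqP E1] /andP[_ /eqP E2].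
  have ll' : l - l' != 0.
    by rewrite subr_eq0; apply: contraNneq ab => ll'; move: E1; rewrite ll' => /addIr ->; rewrite !eqxx.
  congr pair; apply: (mulIf ll').
  have EE t : y + t * l = y' + t * l' -> t * (l - l') = y' - y.
    by move=> e; apply: (addIr (y + t * l')); transitivity (y + t * l); [|rewrite e]; ring.
  by rewrite (EE x1 E1) (EE x2 E2).
have cauchy := card_collisions (f x) (setX Y L).
rewrite -/(W x) -/(E x) cardsX -/z in cauchy.
exists x; move: pT; rewrite -(cardsID [set q | q.2.1 == q.2.2] T) => /leq_trans /(_ (leq_add T1 T2)).
have := prime_gt0 p_pr.
have z0 : (0 < z)%N by rewrite muln_gt0 L_gt0 andbT; apply/card_gt0P; exists 0.
move: cauchy z0; move: (E x) #|W x| (z) => e w z1; clear.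
move=> cauchy z0 p0 pe.
have pzw : (p * z1 <= w * (p + z1))%N.
  rewrite -(leq_pmul2r z0); apply: (@leq_trans (p * (w * e))).
    by rewrite -mulnA leq_mul2l mulnn cauchy orbT.
  by have := leq_mul (leqnn w) pe; clear; lia.
by case: (leqP z1 p) => zp; nia.
Qed.

(* Pivoting: the set [Y + x L] is large for some [x] which is either a
   difference quotient [(y1 - y2) / (l1 - l2)] or such a quotient plus one;
   multiplying by [l1 - l2] clears the denominator. *)
Lemma sum_product (P1 P2 V : {set F}) :
  (forall l y, l \in L -> y \in Y -> l * y \in P1) ->
  (forall l y, l \in L -> y \in P1 -> l * y \in P2) ->
  (forall a b c d e g, a \in P1 -> b \in P1 -> c \in P1 -> d \in P1 ->
    e \in P2 -> g \in P2 -> a - b + c - d + e - g \in V) ->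
  (minn (#|Y| * #|L|) p <= 2 * #|V|)%N.
Proof.
move=> LY_P1 LP1_P2 P1P2_V; have [l0 l0L] := card_gt0P L_gt0.
have P1_0 : 0 \in P1 by rewrite -(mulr0 l0) LY_P1.
have P2_0 : 0 \in P2 by rewrite -(mulr0 l0) LP1_P2.
pose scale a x := [set a * w | w in W x].
have card_scale a x : a != 0 -> #|scale a x| = #|W x|.
  by move=> a0; apply: card_imset; apply: mulfI.
suff [a [x [a0 Wx aV]]] : exists a x, [/\ a != 0,
    (minn (#|Y| * #|L|) p <= 2 * #|W x|)%N & scale a x \subset V].
  by apply: leq_trans Wx _; rewrite -(card_scale a x) // leq_mul2l /= subset_leq_card.
(* A single [l0] admits no difference quotient; then [x = 0] and the scalar [l0] serve directly. *)
have [L1|L2] := leqP #|L| 1.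
  have l00 : l0 != 0 by apply: L0.
  exists l0, 0; split=> //.
    rewrite card_sumset_notin; first by rewrite geq_min; apply/orP; left; rewrite leq_pmull.
    apply/existsP => -[[[y y'] [l l']]] /and5P[/= _ _ lL lL' /andP[ll' _]].
    by case/eqP: ll'; apply: (card_le1_eqP L1).
  apply/subsetP => _ /imsetP[_ /imsetP[[y l] + ->] ->]; rewrite in_setX => /andP[/= yY lL].
  rewrite (_ : _ * _ = l0 * y - 0 + 0 - 0 + 0 - 0); last by rewrite /f /=; ring.
  by apply: P1P2_V => //; apply: LY_P1.
have [l1 [l2 [l1L l2L l12]]] : exists l1 l2, [/\ l1 \in L, l2 \in L & l1 != l2].
  by case/card_gt1P: L2 => l1 [l2 [? ? ?]]; exists l1, l2.
have quotient0 : quotient_ratio 0.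
  apply/existsP; exists ((0, 0), (l1, l2)); rewrite /= Y0 l1L l2L l12 /=.
  by apply/eqP; ring.
have quotient_or (x e : F) : quotient_ratio x -> (e == 0) || (e == 1) ->
    exists2 a, a != 0 & scale a (x + e) \subset V.
  case/existsP => -[[y1 y2] [k1 k2]] /and5P[/= y1Y y2Y k1L k2L /andP[k12 /eqP yx]] e01.
  exists (k1 - k2); first by rewrite subr_eq0.
  have eY : e \in Y by case/orP: e01 => /eqP ->.
  apply/subsetP => _ /imsetP[_ /imsetP[[y l] + ->] ->]; rewrite in_setX => /andP[/= yY lL].
  (* Expanding and replacing [x (k1 - k2)] by [y1 - y2] leaves the six terms allowed in [V]; as [e]
     is 0 or 1, it lies in [Y]. *)
  have -> : (k1 - k2) * f (x + e) (y, l) = k1 * y - k2 * y + l * y1 - l * y2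
      + k1 * (l * e) - k2 * (l * e).
    transitivity ((k1 - k2) * y + l * (x * (k1 - k2)) + (k1 - k2) * (l * e)).
      by rewrite /f /=; ring.
    by rewrite -yx; ring.
  by apply: P1P2_V; rewrite ?LP1_P2 ?LY_P1.
have [/forallP all_quot|] := boolP [forall x, quotient_ratio x].
  have [x Wx] := exists_large_sumset.
  have [|a a0 aV] := quotient_or x 0 (all_quot x); first by rewrite eqxx.
  by exists a, x; rewrite addr0 in aV.
rewrite negb_forall => /existsP[x0 x0Q].
(* Adding 1 repeatedly leads from the quotient 0 to the non-quotient [x0], because 1 generates the
   additive group of a prime field; some step leaves the set of quotients. *)
have [x xQ x1Q] : exists2 x, quotient_ratio x & ~~ quotient_ratio (x + 1).
  have [n x0n] : exists n : nat, n%:R = x0 by exists x0; rewrite natr_Zp.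
  elim: n x0 x0n x0Q => [|n IHn] x0 <-; first by rewrite quotient0.
  rewrite -natr1 => nQ; have [n1Q|n1Q] := boolP (quotient_ratio n%:R).
    by exists n%:R.
  exact: (IHn _ erefl).
have [|a a0 aV] := quotient_or x 1 xQ; first by rewrite eqxx orbT.
exists a, (x + 1); split=> //.
rewrite card_sumset_notin // geq_min; apply/orP; left.
by rewrite leq_pmull.
Qed.

End SumProduct.

(** * Growth in SL2 over a prime field *)

(** Here [al = |A|], [be = |A ^ 18|] and [M] counts trace 2 elements. Then
    [(2 M) ^ 104 <= 1296 ^ 26 * al ^ 81], and [al ^ 23] exceeds [1296 ^ 26]. *)
Lemma trace2_small al be M : 1296 ^ 2 <= al -> be ^ 26 <= al ^ 27 ->
  M ^ 4 <= 81 * be ^ 3 -> 2 * M < al.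
Proof.
move=> al_ge be_le M_le; have al0 : 0 < al by apply: leq_trans al_ge; rewrite expn_gt0.
rewrite -(ltn_exp2r _ _ (isT : 0 < 4)) -(ltn_exp2r _ _ (isT : 0 < 26)).
have le1 : (2 * M) ^ 4 <= 1296 * be ^ 3.
  by rewrite expnMn -[1296]/(2 ^ 4 * 81) -mulnA leq_mul2l M_le orbT.
apply: (@leq_ltn_trans ((1296 * be ^ 3) ^ 26)); first by rewrite leq_exp2r.
apply: (@leq_ltn_trans (1296 ^ 26 * al ^ 81)).
  rewrite expnMn leq_mul2l -!expnM mulnC expnM -[81]/(27 * 3) [al ^ _]expnM.
  by rewrite leq_exp2r // be_le orbT.
rewrite -expnM -[4 * 26]/(23 + 81) expnD ltn_pmul2r ?expn_gt0 ?al0 //.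
apply: (@leq_trans ((1296 ^ 2) ^ 23)); last by rewrite leq_exp2r.
by rewrite -expnM ltn_exp2l.
Qed.

(** With [n] unipotents on each line, products give [p n ^ 2 <= 2 be]; insert [n >= al / (2 M)] and
    [M <= 3 be ^ (3/4)]. *)
Lemma prime_vs_growth p al be M n : 1 < n -> p * (n.-1 * n) <= be ->
  al <= 2 * n * M -> M ^ 4 <= 81 * be ^ 3 -> p ^ 2 * al ^ 4 <= 4 * 1296 * be ^ 5.
Proof.
move=> n1 pn_le al_le M_le.
have pn2 : p * n ^ 2 <= 2 * be.
  apply: leq_trans (_ : 2 * (p * (n.-1 * n)) <= _); last by rewrite leq_mul2l.
  by rewrite mulnCA leq_mul2l mulnA -mulnn leq_mul2r; apply/orP; right; apply/orP; right; lia.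
apply: (@leq_trans (p ^ 2 * (2 * n * M) ^ 4)).
  by rewrite leq_mul2l leq_exp2r // al_le orbT.
have -> : p ^ 2 * (2 * n * M) ^ 4 = 16 * (p * n ^ 2) ^ 2 * M ^ 4.
  by rewrite !expnS !expn0; lia.
apply: (@leq_trans (16 * (2 * be) ^ 2 * (81 * be ^ 3))).
  by apply: leq_mul => //; apply: leq_mul => //; rewrite leq_exp2r.
by rewrite expnMn [be ^ 5](expnD be 2 3); lia.
Qed.

Lemma expn_expand N e p y a b k :
  (N ^ a * (e * p * y) ^ b) ^ k = N ^ (a * k) * (e ^ (b * k) * p ^ (b * k)) * (y ^ k) ^ b.
Proof. by rewrite !expnMn -!expnM (mulnC k) !mulnA. Qed.

(** Up to constants, the first two inequalities give [p ^ 52 <= al ^ 31] and the last two give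
    [al ^ 3 <= p ^ 5]. Together [p ^ 156] is at most a constant times [p ^ 155]. *)
Lemma prime_bounded N e : exists K, forall p al be y, 0 < p -> 0 < al ->
  be ^ 26 <= al ^ 27 -> p ^ 2 * al ^ 4 <= N * be ^ 5 ->
  al <= e * p * y -> y ^ 3 <= e * p ^ 2 -> p <= K.
Proof.
exists (N ^ 78 * e ^ 124) => p al be y p0 al0 be_le pal al_le y_le.
have p52 : p ^ 52 <= N ^ 26 * al ^ 31.
  have al104 : 0 < al ^ 104 by rewrite expn_gt0 al0.
  rewrite -(leq_pmul2r al104) -mulnA -expnD.
  apply: (@leq_trans (N ^ 26 * (be ^ 26) ^ 5)).
    rewrite -[52]/(2 * 26) -[104]/(4 * 26) (expnM p) (expnM al) -expnMn.
    by rewrite -(expnM be) mulnC (mulnC 26) (expnM be) -expnMn leq_exp2r // mulnC.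
  by rewrite leq_mul2l -[31 + 104]/(27 * 5) (expnM al) leq_exp2r // be_le orbT.
have p156 : p ^ 156 <= N ^ 78 * e ^ 124 * p ^ 155.
  rewrite -[156]/(52 * 3) (expnM p).
  apply: (@leq_trans ((N ^ 26 * (e * p * y) ^ 31) ^ 3)).
    rewrite leq_exp2r //; apply: leq_trans p52 _.
    by rewrite leq_mul2l leq_exp2r // al_le orbT.
  rewrite (expn_expand N e p y 26 31) -[26 * 3]/78 -[31 * 3]/93.
  apply: (@leq_trans (N ^ 78 * (e ^ 93 * p ^ 93) * (e * p ^ 2) ^ 31)).
    by rewrite leq_mul2l leq_exp2r // y_le orbT.
  rewrite expnMn -(expnM p) -[124]/(93 + 31) -[155]/(93 + 2 * 31) (expnD e) (expnD p).
  have swap a b c d f : a * (b * c) * (d * f) = a * (b * d) * (c * f).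
    by rewrite -!mulnA (mulnCA c).
  by rewrite swap leqnn.
have p155 : 0 < p ^ 155 by rewrite expn_gt0 p0.
by rewrite -(leq_pmul2r p155) -expnS.
Qed.

Section PrimeField.
Variable p : nat.
Hypotheses (p_pr : prime p) (p_gt2 : 2 < p).
Local Notation F := ('F_p).
Local Notation G := (SL2 F).
Variables (A : {set G}) (c : F).
Hypotheses (A1 : 1%g \in A) (AV : (A^-1)%g = A).
Hypotheses (c0 : c != 0%R) (upA : upper 1%R \in A) (loA : lower c \in A).
Local Open Scope ring_scope.

Lemma char_neq2 : (2%:R : F) != 0.
Proof.
rewrite -(dvdn_pcharf (pchar_Fp p_pr)); apply/negP => /(dvdn_leq (isT : (0 < 2)%N)).
by rewrite leqNgt p_gt2.
Qed.

Lemma up_part_add i j x y : x \in up_part A i -> y \in up_part A j ->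
  x + y \in up_part A (i + j).
Proof. by rewrite !inE upD; apply: expX_mul. Qed.

Lemma up_part_opp i x : x \in up_part A i -> - x \in up_part A i.
Proof. by rewrite !inE upN => /(expX_inv AV). Qed.

Lemma up_part_sub i j x y : x \in up_part A i -> y \in up_part A j ->
  x - y \in up_part A (i + j).
Proof. by move=> xi yj; apply: up_part_add => //; apply: up_part_opp. Qed.

Lemma up_part_mult i n l x : l \in mult_part A n -> x \in up_part A i ->
  l * x \in up_part A (n + i + n).
Proof.
case/imsetP => h; rewrite inE => /andP[hA /eqP h21] ->; rewrite !inE => xA.
have -> : upper (e11 h ^+ 2 * x) = (h * upper x * h^-1)%g.
  have h22 : e11 h * e22 h = 1 by rewrite SL2_diag_mul h21 mulr0 addr0.
  by rewrite /upper tvJ h21; apply: SL2_eq; rewrite !tvE; ring.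
by apply: expX_mul; [apply: expX_mul|apply: (expX_inv AV)].
Qed.

Lemma up_part_le i j : (i <= j)%N -> up_part A i \subset up_part A j.
Proof. by move=> ij; apply/subsetP => x; rewrite !inE; apply: expX_le. Qed.

Lemma up_part_0 i : 0 \in up_part A i.
Proof. by rewrite inE up0 expX_one. Qed.

Lemma up_part_1 i : (0 < i)%N -> 1 \in up_part A i.
Proof. by move=> i0; rewrite inE; apply: (expX_le A1 i0); rewrite expg1. Qed.

Lemma up_part_sum_product m n : (0 < m)%N ->
  (minn (#|up_part A m| * #|mult_part A n|) p <= 2 * #|up_part A (6 * m + 16 * n)|)%N.
Proof.
move=> m0; apply: (@sum_product p p_pr _ _ _ _ _ _ (up_part A (n + m + n))
    (up_part A (n + (n + m + n) + n))).
- exact: up_part_0.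
- exact: up_part_1.
- apply/card_gt0P; exists (e11 (1%g : G) ^+ 2); apply: imset_f.
  by rewrite inE expX_one //= SL2E.
- move=> _ /imsetP[h hB ->]; rewrite expf_neq0 //.
  move: hB; rewrite inE => /andP[_ /eqP h21].
  have := SL2_det h; rewrite h21 mulr0 subr0 => hd.
  by apply: contra_eq_neq hd => ->; rewrite mul0r eq_sym oner_eq0.
- by move=> l y lL yY; apply: up_part_mult.
- by move=> l y lL yY; apply: up_part_mult.
move=> a b d e g h aP bP dP eP gP hP.
pose n1 := (n + m + n)%N; pose n2 := (n + n1 + n)%N.
(* Four terms of length [m + 2 n] and two of length [m + 4 n]. *)
have -> : (6 * m + 16 * n = n1 + n1 + n1 + n1 + n2 + n2)%N by rewrite /n2 /n1; clear; lia.
by rewrite up_part_sub // up_part_add // up_part_sub // up_part_add // up_part_sub.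
Qed.

(** The set and its reflection [x - R] each hold at least half of the field; if they were disjoint,
    [p] would be even. *)
Lemma up_part_double m : (p <= 2 * #|up_part A m|)%N -> up_part A (m + m) = setT.
Proof.
move=> pm; apply/setP => x; rewrite in_setT.
pose R := up_part A m; pose R' := [set x - y | y in R].
have cardR' : #|R'| = #|R| by apply: card_imset => y y' /addrI /oppr_inj.
have /set0Pn[y] : R :&: R' != set0.
  apply/eqP => RR'.
  have pE : (p = 2 * #|R|)%N.
    apply/eqP; rewrite eqn_leq pm /= mul2n -addnn -{2}cardR'.
    by rewrite -cardsUI RR' cards0 addn0 -[X in (_ <= X)%N](card_Fp p_pr) max_card.
  have : (2 %| p)%N by rewrite pE dvdn_mulr.
  by rewrite dvdn_prime2 // => /eqP p2; move: p_gt2; rewrite -p2.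
rewrite in_setI => /andP[yR /imsetP[z zR yz]].
rewrite (_ : x = y + z); first exact: up_part_add.
by rewrite yz; ring.
Qed.

End PrimeField.

(** Let [y] count the short [u(x)] after one use of sum-product. Either a sum-product bound already
    covers half the field, or [|A| <= 8 p y] and [y ^ 3 <= 8 p ^ 2], which [prime_bounded] rules out
    for [p > K]. *)
Lemma up_part_full : exists K, forall (p : nat) (p_pr : prime p)
    (A : {set SL2 'F_p}) (c : 'F_p),
  K < p -> 1%g \in A -> (A^-1)%g = A -> c != 0%R -> upper 1%R \in A -> lower c \in A ->
  1296 ^ 2 <= #|A| -> #|(A ^+ 18)%g| ^ 26 <= #|A| ^ 27 ->
  up_part A (56 * 170 + 56 * 170) = setT.
Proof.
have [K KP] := prime_bounded (4 * 1296) 8; exists (maxn K 2) => p p_pr A c.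
rewrite gtn_max => /andP[Kp p2] A1 AV c0 upA loA A_ge A_le.
have full m : m <= 56 * 170 -> p <= 2 * #|up_part A m| -> up_part A (56 * 170 + 56 * 170) = setT.
  move=> mn /(up_part_double p_pr p2) fullm; apply/eqP; rewrite -subTset -fullm.
  by apply: up_part_le => //; apply: leq_add.
have M4 := card_trace2_part (char_neq2 p_pr p2) A1 AV c0 upA loA 8.
rewrite -[2 * 8 + 2]/18 in M4.
have M_small := trace2_small A_ge A_le M4.
have [u_ge l_ge] := card_line_part_orbit A1 AV c0 upA loA M_small.
set M := #|trace2_part A 8| in M4 M_small u_ge l_ge.
set al := #|A| in A_ge A_le M_small u_ge l_ge; set be := #|(A ^+ 18)%g| in A_le M4.
have al0 : 0 < al by apply: leq_trans A_ge; rewrite expn_gt0.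
(* The least such [n] is a common lower bound for the numbers of unipotents on all lines. *)
have ex_n : exists n, al <= 2 * n * M by exists #|up_part A 4|.
case: (ex_minnP ex_n) => n n_ge n_min {ex_n}.
have n1 : 1 < n by rewrite ltnNge; apply/negP => n1; move: M_small n_ge n1; clear; nia.
have pn : p * (n.-1 * n) <= be.
  apply: (@leq_trans #|(A ^+ 8)%g|); last by apply/subset_leq_card/expX_sub.
  apply: (@leq_trans (p * (n.-1 * #|up_part A 4|))).
    by rewrite !leq_mul // n_min.
  rewrite -[X in X * _ <= _](card_Fp p_pr); apply: (card_unipotent_products c0) => x.
  apply: n_min.
  have [j <-] : exists j : nat, (1 + j%:R * c)%R = x.
    by exists ((x - 1) / c)%R; rewrite natr_Zp divfK // addrC subrK.
  exact: l_ge.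
have p2al := prime_vs_growth n1 pn n_ge M4.
have z_ge := leq_card_mult_up AV 1.
rewrite expg1 -/al (card_Fp p_pr) -[4 * 1]/4 -[2 * 1]/2 in z_ge.
have y_ge := up_part_sum_product p_pr A1 AV upA 2 (isT : 0 < 4).
rewrite -[6 * 4 + 16 * 2]/56 in y_ge.
set y := #|up_part A 56| in y_ge.
have [py|yp] := leqP p (2 * y); first exact: full py.
have al_le : al <= 8 * p * y.
  move: z_ge y_ge yp p2; move: (#|_| * #|_|) => z; clear; rewrite geq_min; nia.
have y1 : 1 < y.
  rewrite /y (cardsD1 0%R) up_part_0 // ltnS card_gt0; apply/set0Pn; exists 1%R.
  by rewrite in_setD1 oner_eq0 up_part_1.
(* Triple products make [A ^ 170] of size about [y ^ 3]; its upper triangular quotients feed the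
   second use of sum-product. *)
have y3 := card_up_part_cube c0 loA 56.
rewrite -/y -[3 * 56 + 2]/170 in y3.
have z'_ge := leq_card_mult_up AV 170.
rewrite (card_Fp p_pr) -[4 * 170]/680 -[2 * 170]/340 in z'_ge.
have [pz'|z'p] := leqP p (#|up_part A 680| * #|mult_part A 340|).
  apply: (full _ (leqnn _)).
  have := up_part_sum_product p_pr A1 AV upA 340 (isT : 0 < 680).
  by rewrite (minn_idPr pz') -[6 * 680 + 16 * 340]/(56 * 170).
suff pK : p <= K by move: Kp; rewrite ltnNge pK.
apply: (KP p al be y (prime_gt0 p_pr) al0 A_le p2al al_le).
have : y * (y.-1 * y) <= 2 * p.+1 * p.
  by apply: leq_trans y3 _; apply: leq_trans z'_ge _; rewrite leq_mul2l ltnW ?orbT.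
move: (y) y1 p2; clear; move=> [|[|y]] // _ p2; rewrite !expnS expn0 /= => ylt.
nia.
Qed.

(** * Finding a scale without growth *)

Definition SL2_gens (F : finFieldType) (c : F) : {set SL2 F} :=
  [set g | (g \in [:: 1; upper 1%R; (upper 1%R)^-1; lower c; (lower c)^-1])%g].

Section SL2Gens.
Variables (F : finFieldType) (c : F).
Local Notation X := (SL2_gens c).
Local Open Scope group_scope.

Lemma SL2_gens_1 : 1 \in X. Proof. by rewrite !inE eqxx. Qed.
Lemma SL2_gens_up : upper 1%R \in X. Proof. by rewrite !inE eqxx !orbT. Qed.
Lemma SL2_gens_lo : lower c \in X. Proof. by rewrite !inE eqxx !orbT. Qed.

Lemma SL2_gens_inv : X^-1 = X.
Proof.
apply/setP => g; rewrite !inE !(can2_eq invgK invgK) invg1 !invgK.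
by do 5!case: (g == _).
Qed.

Lemma SL2_gens_up_nat n : upper n%:R%R \in X ^+ n.
Proof.
elim: n => [|n IHn]; first by rewrite up0 expg0 set11.
by rewrite -natr1 upD expgSr mem_mulg ?SL2_gens_up.
Qed.

End SL2Gens.

Lemma leq_card_SL2_gens p (c : 'F_p) m : prime p -> m < p ->
  m <= #|((SL2_gens c) ^+ m)%g|.
Proof.
move=> p_pr mp; rewrite -[X in X <= _](card_ord m) -cardsT.
apply: (@leq_card_inj _ _ (fun i : 'I_m => upper (i%:R)%R)) => [i _|i j _ _ /up_inj].
  exact: (expX_le (SL2_gens_1 c) (ltnW (ltn_ord i)) (SL2_gens_up_nat c i)).
move/(congr1 val); rewrite /= !val_Fp_nat // !modn_small; first exact: val_inj.
- exact: ltn_trans mp.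
- exact: ltn_trans mp.
Qed.

(** Bernoulli's inequality for [(1 + 1 / k) ^ n], with denominators cleared. *)
Lemma bernoulli_nat k n : (k + n) * k ^ n <= k * k.+1 ^ n.
Proof.
elim: n => [|n IHn]; first by rewrite addn0 !expn0.
rewrite [k.+1 ^ _]expnS mulnCA; apply: leq_trans (leq_mul (leqnn k.+1) IHn).
by rewrite expnS; move: (k ^ n) => u; nia.
Qed.

(** While growth persists, [a n ^ (26 ^ n) >= 2 ^ (27 ^ n)] by induction. Against [a n <= p ^ 4]
    this must fail; the first failure is taken, so that the bound still holds there. *)
Lemma growth_stops p (a : nat -> nat) : 0 < p -> 1 < a 0 -> (forall i, a i <= p ^ 4) ->
  exists n, a n.+1 ^ 26 <= a n ^ 27 /\ 2 ^ (27 ^ n) <= p ^ (4 * 26 ^ n).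
Proof.
move=> p0 a0 a_le; pose P n := a n.+1 ^ 26 <= a n ^ 27.
have a_ge n : (forall i, i < n -> ~~ P i) -> 2 ^ (27 ^ n) <= p ^ (4 * 26 ^ n).
  move=> nP; rewrite expnM; apply: (@leq_trans (a n ^ (26 ^ n))); last first.
    by rewrite leq_exp2r ?expn_gt0.
  elim: n nP => [|n IHn] nP; first by rewrite !expn0 expn1.
  have {}IHn := IHn (fun i lt_in => nP i (ltnW lt_in)).
  rewrite !expnS !(mulnC _ (_ ^ n)) expnM; apply: (@leq_trans ((a n ^ (26 ^ n)) ^ 27)).
    by rewrite leq_exp2r.
  rewrite -expnM mulnC expnM [_ * 26]mulnC expnM leq_exp2r ?expn_gt0 //.
  by rewrite ltnW // ltnNge; apply: nP.
have exP : exists n, P n.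
  (* Since [104 = 4 * 26], Bernoulli gives [(1 + 4 p) u <= v] for the powers [u], [v] below, against
     [v <= 4 p u]. *)
  have [/existsP[i Pi]|] := boolP [exists i : 'I_(104 * p), P i]; first by exists i.
  rewrite negb_exists => /forallP nP.
  have := a_ge (104 * p) (fun i lt_i => nP (Ordinal lt_i)).
  have := bernoulli_nat 26 (104 * p).
  set u := 26 ^ _; set v := 27 ^ _ => uv pv.
  have : 2 ^ v <= 2 ^ (p * (4 * u)).
    apply: leq_trans pv _; rewrite [2 ^ _]expnM leq_exp2r ?muln_gt0 ?expn_gt0 //.
    by rewrite ltnW // ltn_expl.
  rewrite leq_exp2l // => vp.
  have u0 : 0 < u by rewrite expn_gt0.
  by exfalso; move: uv vp u0; clear; nia.
case: (ex_minnP exP) => n Pn n_min; exists n; split=> //; apply: a_ge => i lt_in.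
by apply: contraL lt_in => /n_min; rewrite -leqNgt.
Qed.

Lemma up_part_expg (F : finFieldType) (X : {set SL2 F}) k m :
  up_part (X ^+ k)%g m = up_part X (k * m).
Proof. by apply/setP => x; rewrite !inE expgM. Qed.

Lemma card_SL2 (F : finFieldType) : #|{: SL2 F}| <= #|F| ^ 4.
Proof.
rewrite card_sub; apply: leq_trans (max_card _) _.
by rewrite !card_prod !expnS expn0 muln1 !mulnA.
Qed.

(** Balls of radius [m * 18 ^ i] are compared, so that consecutive ones are [A] and [A ^ 18]. The
    base radius [m] makes each of them large enough for [up_part_full]. *)
Lemma SL2_up_short : exists C, forall (p : nat) (c : 'F_p), prime p -> c != 0%R ->
  exists k n : nat, [/\ up_part (SL2_gens c) k = setT, k <= C * 18 ^ n &
    2 ^ (27 ^ n) <= p ^ (4 * 26 ^ n)].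
Proof.
have [K KP] := up_part_full.
have [m mE] : exists m, m = 1296 ^ 2 by exists (1296 ^ 2).
exists (m * (56 * 170 + 56 * 170) + (maxn K m)) => p c p_pr c0.
have p0 := prime_gt0 p_pr.
have [Kp|pK] := ltnP (maxn K m) p; last first.
  (* For bounded [p], powers of [upper 1] reach everything and the constant absorbs the length. *)
  exists p, 0; split.
  - apply/setP => x; rewrite in_setT inE.
    have xp : x <= p.
      by rewrite ltnW // -[X in _ < X](Fp_cast p_pr).
    by rewrite -[x in upper x]natr_Zp (expX_le (SL2_gens_1 c) xp) ?SL2_gens_up_nat.
  - by rewrite expn0 muln1; apply: leq_trans pK _; rewrite leq_addl.
  - by rewrite !expn0 expn1 muln1; apply: leq_trans (prime_gt1 p_pr) _; rewrite -[X in X <= _]expn1 leq_pexp2l.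
rewrite gtn_max in Kp; case/andP: Kp => Kp mp.
pose a i := #|((SL2_gens c) ^+ (m * 18 ^ i))%g|.
have a_mono i : m <= a i.
  apply: leq_trans (leq_card_SL2_gens c p_pr mp) _; apply/subset_leq_card.
  by apply: (expX_sub (SL2_gens_1 c)); rewrite leq_pmulr ?expn_gt0.
have [|i|n [an_le n_le]] := @growth_stops p a p0.
- by apply: leq_trans (a_mono 0); rewrite mE.
- by apply: leq_trans (max_card _) _; apply: leq_trans (card_SL2 _) _; rewrite card_Fp.
exists (m * 18 ^ n * (56 * 170 + 56 * 170)), n; split=> //; last first.
  by rewrite mulnAC leq_mul2r leq_addr orbT.
rewrite -up_part_expg; apply: (KP p p_pr _ c Kp) => //.
- exact: (expX_one (SL2_gens_1 c)).
- exact: (expX_invg (SL2_gens_inv c)).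
- apply: (expX_le (SL2_gens_1 c) (i := 1)); last by rewrite expg1 SL2_gens_up.
  by rewrite muln_gt0 expn_gt0 /= mE.
- apply: (expX_le (SL2_gens_1 c) (i := 1)); last by rewrite expg1 SL2_gens_lo.
  by rewrite muln_gt0 expn_gt0 /= mE.
- by rewrite -mE; apply: a_mono.
by rewrite -expgM -mulnA -expnSr.
Qed.

Local Open Scope ring_scope.

(** * Reduction to SL2 *)

Lemma invmx_mul (F : fieldType) n (a b : 'M[F]_n) : a \in unitmx -> b \in unitmx ->
  invmx (a *m b) = invmx b *m invmx a.
Proof.
move=> au bu; have abu : a *m b \in unitmx by rewrite unitmx_mul au.
apply: (can_inj (mulKmx abu)).
by rewrite mulmxV // -mulmxA (mulmxA b) mulmxV // mul1mx mulmxV.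
Qed.

Section SetPow.
Variables (F : fieldType) (n : nat) (X : 'M[F]_n -> Prop).

Lemma setpow_mul i j a b : setpow X i a -> setpow X j b -> setpow X (i + j) (a *m b).
Proof.
move=> ia; elim: j b => [b ->|j IHj b [b1 [b2 [jb1 [Xb2 ->]]]]].
  by rewrite addn0 mulmx1.
by rewrite addnS; exists (a *m b1), b2; split; [apply: IHj|rewrite mulmxA].
Qed.

Lemma setpow1 a : X a -> setpow X 1 a.
Proof. by move=> Xa; exists 1%:M, a; rewrite mul1mx. Qed.

Hypothesis X1 : X 1%:M.

Lemma setpow_le i j a : (i <= j)%N -> setpow X i a -> setpow X j a.
Proof.
move=> /subnK <-; elim: (j - i)%N => [//|k IHk] ia.
by exists a, 1%:M; split; [apply: IHk|rewrite mulmx1].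
Qed.

Hypothesis Xinv : forall x, X x -> X (invmx x).
Hypothesis Xunit : forall x, X x -> x \in unitmx.

Lemma setpow_unit k a : setpow X k a -> a \in unitmx.
Proof.
elim: k a => [a ->|k IHk a [b [x [kb [Xx ->]]]]]; first exact: unitmx1.
by rewrite unitmx_mul IHk ?Xunit.
Qed.

Lemma setpow_inv k a : setpow X k a -> setpow X k (invmx a).
Proof.
elim: k a => [a ->|k IHk a [b [x [kb [Xx ->]]]]]; first by rewrite /= invmx1.
rewrite invmx_mul ?(setpow_unit kb) ?Xunit //.
by rewrite -add1n; apply: setpow_mul; [apply/setpow1/Xinv|apply: IHk].
Qed.

End SetPow.

(** The block matrix [B] factors into triangular ones in two ways. *)
Lemma det_add1_mulmx (F : fieldType) n (w : 'cV[F]_n) (th : 'rV[F]_n) :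
  \det (1%:M + w *m th) = 1 + (th *m w) 0 0.
Proof.
pose B : 'M[F]_(1 + n) := block_mx 1%:M (- th) w 1%:M.
have B1 : B = block_mx 1%:M 0 w 1%:M *m block_mx 1%:M (- th) 0 (1%:M + w *m th).
  by rewrite mulmx_block !mul1mx !mulmx1 !mul0mx !addr0 mulmxN addrCA addNr addr0.
have B2 : B = block_mx 1%:M (- th) 0 1%:M *m block_mx (1%:M + th *m w) 0 w 1%:M.
  by rewrite mulmx_block !mul1mx !mulmx1 !mul0mx mulNmx addrK !add0r.
transitivity (\det B).
  by rewrite B1 det_mulmx det_lblock det_ublock !det1 !mul1r.
by rewrite B2 det_mulmx det_lblock det_ublock !det1 !mul1r mulr1 det_mx11 !mxE.
Qed.

Lemma mulmx11_eq0 (F : fieldType) (a b : 'M[F]_1) : (a *m b == 0) = (a == 0) || (b == 0).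
Proof.
have eq0 (m : 'M[F]_1) : (m == 0) = (m 0 0 == 0).
  by apply/eqP/eqP => [->|m0]; [rewrite mxE|apply/matrixP => i j; rewrite !ord1 m0 mxE].
by rewrite !eq0 mxE big_ord1 mulf_eq0.
Qed.

(** Otherwise the dimension grows at every step and overtakes that of the whole space. *)
Lemma vspace_chain_stable (K : fieldType) (vT : vectType K) (W : nat -> {vspace vT}) :
  (forall k, (W k <= W k.+1)%VS) ->
  exists2 k, (k <= \dim {:vT})%N & W k.+1 = W k.
Proof.
move=> W_mono; have [[k kd Wk]|strict] := pselect (exists2 k, (k <= \dim {:vT})%N & W k.+1 = W k).
  by exists k.
have dimW k : (k <= (\dim {:vT}).+1)%N -> (k <= \dim (W k))%N.
  elim: k => [//|k IHk] kd; apply: leq_ltn_trans (IHk (ltnW kd)) _.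
  rewrite ltn_neqAle dimvS // andbT; apply/negP => /eqP dimE; apply: strict.
  by exists k => //; apply/eqP; rewrite eq_sym eqEdim W_mono dimE /=.
have := dimW _ (leqnn _); rewrite leqNgt => /negP[].
by rewrite ltnS dimvS ?subvf.
Qed.

(** The transvection [1 + w th] with [phi w = th d = 1] and [th w = 0] works; its inverse is
    [1 - w th]. *)
Lemma SL_separating (F : fieldType) n (d : 'cV[F]_n) (phi : 'rV[F]_n) :
  d != 0 -> phi != 0 -> phi *m d = 0 ->
  exists g, in_SL g /\ phi *m g *m d != 0 /\ phi *m invmx g *m d != 0.
Proof.
move=> d0 phi0 phid.
have [i di] : exists i, d i 0 != 0.
  by apply: contrapT => /forallNP di; case/eqP: d0; apply/colP => i; rewrite mxE; apply/eqP/negP => /negP/di.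
have [j phij] : exists j, phi 0 j != 0.
  by apply: contrapT => /forallNP pj; case/eqP: phi0; apply/rowP => j; rewrite mxE; apply/eqP/negP => /negP/pj.
pose w : 'cV[F]_n := (phi 0 j)^-1 *: delta_mx j 0.
pose th0 : 'rV[F]_n := (d i 0)^-1 *: delta_mx 0 i.
have phiw : phi *m w = 1%:M.
  apply/matrixP => a b; rewrite !ord1 -scalemxAr -colE !mxE /= mulVf //.
have th0d : th0 *m d = 1%:M.
  by apply/matrixP => a b; rewrite !ord1 -scalemxAl -rowE !mxE /= mulVf.
(* Subtracting a multiple of [phi] kills the value at [w] and keeps the value at [d], as
   [phi d = 0]. *)
pose th := th0 - th0 *m w *m phi.
have thd : th *m d = 1%:M by rewrite mulmxBl -!mulmxA phid !mulmx0 subr0.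
have thw : th *m w = 0 by rewrite mulmxBl -!mulmxA phiw mulmx1 subrr.
have gu : (1%:M - w *m th) *m (1%:M + w *m th) = 1%:M.
  rewrite mulmxDr mulmx1 mulmxBl mul1mx -mulmxA (mulmxA th) thw mul0mx mulmx0 subr0.
  by rewrite addrNK.
have ginv : invmx (1%:M + w *m th) = 1%:M - w *m th.
  have g'u : 1%:M + w *m th \in unitmx by case/mulmx1_unit: gu.
  by apply: (can_inj (mulmxK g'u)); rewrite gu mulVmx.
exists (1%:M + w *m th); split.
  by rewrite /in_SL det_add1_mulmx thw mxE addr0.
have gd : phi *m (1%:M + w *m th) *m d = 1%:M.
  by rewrite mulmxDr mulmx1 mulmxDl phid add0r mulmxA phiw mul1mx thd.
have g'd : phi *m (1%:M - w *m th) *m d = - 1%:M.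
  by rewrite mulmxBr mulmx1 mulmxBl phid sub0r mulmxA phiw mul1mx thd.
rewrite ginv gd g'd oppr_eq0; split; apply/eqP => /matrixP/(_ 0 0); rewrite !mxE /=;
  exact/eqP/oner_neq0.
Qed.

Section Separation.
Variables (p n : nat) (X : 'M['F_p]_n -> Prop).
Hypotheses (X1 : X 1%:M) (Xinv : forall x, X x -> X (invmx x)).
Hypothesis Xunit : forall x, X x -> x \in unitmx.
Hypothesis Xgen : forall g, in_SL g -> in_gen X g.

(* The spans of the conjugates of [d *m phi] by [X ^ k] form a chain of subspaces
   of matrices, so they stabilise, at an invariant subspace, for some [k <= n ^ 2]. *)
Lemma short_separating (d : 'cV['F_p]_n) (phi : 'rV['F_p]_n) :
  d != 0 -> phi != 0 -> phi *m d = 0 ->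
  exists g, setpow X (n ^ 2) g /\ phi *m g *m d != 0 /\ phi *m invmx g *m d != 0.
Proof.
move=> d0 phi0 phid; pose E := d *m phi.
pose W k := <<[seq x *m E *m invmx x | x in [set x | `[<setpow X k x>]]]>>%VS.
have inW k x : setpow X k x -> x *m E *m invmx x \in W k.
  move=> kx; apply/memv_span/imageP; exists x => //.
  by rewrite inE; apply/asboolP.
have [k kn Wk] : exists2 k, (k <= \dim {:'M['F_p]_n})%N & W k.+1 = W k.
  apply: vspace_chain_stable => k; apply/span_subvP => _ /imageP[x + ->].
  by rewrite inE => /asboolP kx; apply/inW/(setpow_le X1 (leqnSn k)).
have kn2 : (k <= n ^ 2)%N by apply: leq_trans kn _; rewrite dimvf /dim /= mulnn.
(* Conjugation by [X] maps [W k] into [W k.+1 = W k], so all of SL(V) preserves it. *)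
pose stab g := forall m, m \in W k -> g *m m *m invmx g \in W k.
have stabX x : X x -> stab x.
  move=> Xx m; pose f : {linear 'M['F_p]_n -> 'M['F_p]_n} := mulmxr (invmx x) \o mulmx x.
  move=> mW; rewrite -[_ *m _]/(f m) -(lfunE f).
  have /subvP : (W k <= linfun f @^-1: W k)%VS.
    apply/span_subvP => _ /imageP[y + ->]; rewrite inE => /asboolP ky.
    rewrite -memv_preim lfunE /= -Wk.
    have -> : x *m (y *m E *m invmx y) *m invmx x = (x *m y) *m E *m invmx (x *m y).
      by rewrite invmx_mul ?(setpow_unit Xunit ky) ?Xunit // !mulmxA.
    by apply: inW; rewrite -add1n; apply: setpow_mul => //; apply: setpow1.
  by move=> /(_ m mW); rewrite -memv_preim.
have stabM g h : g \in unitmx -> h \in unitmx -> stab g -> stab h -> stab (g *m h).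
  move=> gu hu gW hW m /hW /gW; rewrite invmx_mul //.
  by rewrite !mulmxA.
have stab_gen g : in_gen X g -> g \in unitmx /\ stab g /\ stab (invmx g).
  elim=> {g} [x Xx||g h _ [gu [gW gW']] _ [hu [hW hW']]|g _ [gu [gW gW']]].
  - by split; [apply: Xunit|split; apply: stabX => //; apply: Xinv].
  - by rewrite invmx1 unitmx1; do !split=> //; move=> m; rewrite invmx1 mul1mx mulmx1.
  - split; first by rewrite unitmx_mul gu hu.
    split; first exact: stabM.
    by rewrite (invmx_mul gu hu); apply: stabM => //; rewrite unitmx_inv.
  - by rewrite unitmx_inv invmxK.
apply: contrapT => none.
(* If no short element separates, the functional [m |-> phi m d] vanishes on the spanning
   conjugates, since on each it is a product of the two scalars. *)
have Wker m : m \in W k -> phi *m m *m d = 0.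
  pose f : {linear 'M['F_p]_n -> 'M['F_p]_1} := mulmxr d \o mulmx phi.
  have /subvP WkerP : (W k <= lker (linfun f))%VS.
    apply/span_subvP => _ /imageP[x + ->]; rewrite inE => /asboolP kx.
    rewrite memv_ker lfunE /= /E !mulmxA -mulmxA.
    have [->|phix] := eqVneq (phi *m x *m d) 0; first by rewrite -!mulmxA mul0mx.
    have [phix'|phix'] := eqVneq (phi *m invmx x *m d) 0.
      by rewrite -!mulmxA (mulmxA phi (invmx x)) phix' !mulmx0.
    by case: none; exists x; split=> //; apply: (setpow_le X1 kn2).
  by move=> /WkerP; rewrite memv_ker lfunE /= => /eqP.
have [g [gSL [phig phig']]] := SL_separating d0 phi0 phid.
have [gu [gW _]] := stab_gen g (Xgen gSL).
have EW : E \in W k.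
  have := inW k 1%:M; rewrite mul1mx invmx1 mulmx1; apply.
  by apply: (setpow_le X1 (leq0n k)).
have := Wker _ (gW _ EW).
have -> : phi *m (g *m E *m invmx g) *m d = (phi *m g *m d) *m (phi *m invmx g *m d).
  by rewrite /E !mulmxA.
by apply/eqP; rewrite mulmx11_eq0 negb_or phig.
Qed.

End Separation.

(** * The copy of SL2 generated by two transvections *)

Section Embedding.
Variables (F : finFieldType) (n : nat).
Variables (D : 'M[F]_(n, 1 + 1)) (Phi : 'M[F]_(1 + 1, n)).
Hypothesis PhiD : Phi *m D = 1%:M.

Definition SL2_mx (g : SL2 F) : 'M[F]_(1 + 1) :=
  block_mx (e11 g)%:M (e12 g)%:M (e21 g)%:M (e22 g)%:M.

(** When [Phi *m D = 1], this acts as [g] on the span of the columns of [D] and trivially on the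
    kernel of [Phi]. *)
Definition SL2_embed (g : SL2 F) : 'M[F]_n := 1%:M + D *m (SL2_mx g - 1%:M) *m Phi.

Lemma SL2_mxM g h : SL2_mx (g * h)%g = SL2_mx g *m SL2_mx h.
Proof.
rewrite /SL2_mx mulmx_block !SL2E -!scalar_mxM -!raddfD; congr block_mx.
Qed.

Lemma SL2_embedM g h : SL2_embed (g * h)%g = SL2_embed g *m SL2_embed h.
Proof.
have expand k (u v : 'M[F]_k) : (1%:M + u) *m (1%:M + v) = 1%:M + (v + u + u *m v).
  by rewrite mulmxDl mul1mx mulmxDr mulmx1 !addrA.
rewrite /SL2_embed SL2_mxM expand.
have -> : D *m (SL2_mx g - 1%:M) *m Phi *m (D *m (SL2_mx h - 1%:M) *m Phi) =
    D *m ((SL2_mx g - 1%:M) *m (SL2_mx h - 1%:M)) *m Phi.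
  by rewrite !mulmxA -(mulmxA _ Phi D) PhiD mulmx1.
rewrite -!mulmxDl -!mulmxDr; congr (_ + _ *m _ *m _).
have addK (m : 'M[F]_(1 + 1)) : m = 1%:M + (m - 1%:M) by rewrite addrC subrK.
by rewrite {1}(addK (SL2_mx g)) {1}(addK (SL2_mx h)) expand [1%:M + _]addrC addrK.
Qed.

Lemma SL2_embed1 : SL2_embed 1%g = 1%:M.
Proof.
rewrite /SL2_embed (_ : SL2_mx _ = 1%:M) ?subrr ?mulmx0 ?mul0mx ?addr0 //.
by rewrite /SL2_mx !SL2E scalar_mx_block raddf0.
Qed.

Lemma SL2_embedV g : SL2_embed g^-1%g = invmx (SL2_embed g).
Proof.
have gVg : SL2_embed g^-1%g *m SL2_embed g = 1%:M by rewrite -SL2_embedM mulVg SL2_embed1.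
have [_ gu] := mulmx1_unit gVg.
by apply: (can_inj (mulmxK gu)); rewrite gVg mulVmx.
Qed.

End Embedding.

Lemma SL2_embed_up (F : finFieldType) n (d0 d1 : 'cV[F]_n) (f0 f1 : 'rV[F]_n) x :
  SL2_embed (row_mx d0 d1) (col_mx f0 f1) (upper x) = 1%:M + x *: (d0 *m f1).
Proof.
rewrite /SL2_embed (_ : SL2_mx _ - _ = block_mx 0 x%:M 0 0).
  by rewrite mul_row_block !mulmx0 !addr0 ?add0r mul_row_col mul0mx add0r mul_mx_scalar scalemxAl.
by rewrite /SL2_mx !upE scalar_mx_block opp_block_mx add_block_mx !subrr !raddf0 !addr0.
Qed.

Lemma SL2_embed_lo (F : finFieldType) n (d0 d1 : 'cV[F]_n) (f0 f1 : 'rV[F]_n) x :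
  SL2_embed (row_mx d0 d1) (col_mx f0 f1) (lower x) = 1%:M + x *: (d1 *m f0).
Proof.
rewrite /SL2_embed (_ : SL2_mx _ - _ = block_mx 0 0 x%:M 0).
  by rewrite mul_row_block !mulmx0 !addr0 ?add0r mul_row_col mul0mx addr0 mul_mx_scalar scalemxAl.
by rewrite /SL2_mx !upE scalar_mx_block opp_block_mx add_block_mx !subrr !raddf0 !addr0.
Qed.

Lemma SL2_embed_setpow (p n : nat) (X : 'M['F_p]_n -> Prop) D Phi (c : 'F_p) L k g :
  Phi *m D = 1%:M -> (forall x, x \in SL2_gens c -> setpow X L (SL2_embed D Phi x)) ->
  g \in (SL2_gens c ^+ k)%g -> setpow X (L * k) (SL2_embed D Phi g).
Proof.
move=> PhiD gens; elim: k g => [|k IHk] g.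
  by rewrite expg0 => /set1P ->; rewrite muln0 /= SL2_embed1.
rewrite expgSr => /mulsgP[h x hk xX ->]; rewrite SL2_embedM // mulnS addnC.
by apply: setpow_mul; [apply: IHk|apply: gens].
Qed.

(** The generators of SL2 become [t], [g t g^-1] and their inverses; with [g] in [X ^ (n ^ 2)] each
    costs at most [2 * n ^ 2 + 1] letters. *)
Lemma transvection_group_short (p n : nat) (X : 'M['F_p]_n -> Prop) t :
  X 1%:M -> (forall x, X x -> X (invmx x)) -> (forall x, X x -> in_SL x) ->
  (forall g, in_SL g -> in_gen X g) -> X t -> is_transvection t ->
  exists2 c : 'F_p, c != 0 & forall k, up_part (SL2_gens c) k = setT ->
    forall g, transvection_group t g -> setpow X ((2 * n ^ 2 + 1) * k) g.
Proof.
move=> X1 Xinv XSL Xgen Xt [d [phi [d0 phi0 phid tE]]].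
have Xunit x : X x -> x \in unitmx by move=> /XSL xSL; rewrite unitmxE xSL unitr1.
have [g [gn [phig phig']]] := short_separating X1 Xinv Xunit Xgen d0 phi0 phid.
have gu := setpow_unit Xunit gn.
pose b := g *m d; pose psi := phi *m invmx g.
pose be := (phi *m b) 0 0; pose ga := (psi *m d) 0 0.
have scal (m : 'M['F_p]_1) : m = (m 0 0)%:M by apply: mx11_scalar.
have phib : phi *m b = be%:M by rewrite [LHS]scal.
have psid : psi *m d = ga%:M by rewrite [LHS]scal.
have nz (a : 'F_p) : a%:M != 0 :> 'M['F_p]_1 -> a != 0.
  by apply: contraNneq => ->; rewrite raddf0.
have be0 : be != 0 by apply: nz; rewrite -phib /b mulmxA.
have ga0 : ga != 0 by apply: nz; rewrite -psid.
have psib : psi *m b = 0.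
  by rewrite /psi /b -mulmxA (mulmxA _ g) mulVmx // mul1mx.
exists (be * ga) => [|k kT h [lam ->]]; first exact: mulf_neq0.
(* The scalars make the two bases dual and turn [t] into [upper 1]; then [g t g^-1] is
   [lower (be * ga)]. *)
pose D := row_mx (be *: d) b; pose Phi := col_mx ((be * ga)^-1 *: psi) (be^-1 *: phi).
have PhiD : Phi *m D = 1%:M.
  rewrite mul_col_row -!scalemxAl -!scalemxAr phid psid phib psib !scaler0 scalar_mx_block.
  by rewrite !scale_scalar_mx; congr block_mx; congr (_%:M); field; rewrite ?be0 ?ga0.
have embed_up x : SL2_embed D Phi (upper x) = 1%:M + x *: (d *m phi).
  have dphi : (be *: d) *m (be^-1 *: phi) = d *m phi.
    by rewrite -scalemxAl -scalemxAr scalerA mulfV // scale1r.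
  by rewrite SL2_embed_up dphi.
have embed_lo : SL2_embed D Phi (lower (be * ga)) = g *m t *m invmx g.
  rewrite SL2_embed_lo -scalemxAr scalerA mulfV ?mulf_neq0 // scale1r.
  by rewrite tE mulmxDr mulmxDl mulmx1 mulmxV // /b /psi !mulmxA.
have n1 : (1 <= 2 * n ^ 2 + 1)%N by rewrite addn1.
have tn : setpow X (2 * n ^ 2 + 1) t by apply: (setpow_le X1 n1); apply: setpow1.
have gtn : setpow X (2 * n ^ 2 + 1) (g *m t *m invmx g).
  have -> : (2 * n ^ 2 + 1 = n ^ 2 + 1 + n ^ 2)%N by clear; lia.
  apply: setpow_mul; last exact: (setpow_inv Xinv Xunit).
  by apply: setpow_mul => //; apply: setpow1.
rewrite tE (addrAC 1%:M) subrr add0r -embed_up; apply: (SL2_embed_setpow PhiD (c := be * ga)).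
  have inv_mem x : setpow X (2 * n ^ 2 + 1) (SL2_embed D Phi x) ->
      setpow X (2 * n ^ 2 + 1) (SL2_embed D Phi x^-1%g).
    by rewrite SL2_embedV //; apply: (setpow_inv Xinv Xunit).
  have up1 : setpow X (2 * n ^ 2 + 1) (SL2_embed D Phi (upper 1)).
    by rewrite embed_up scale1r -tE.
  have lo1 : setpow X (2 * n ^ 2 + 1) (SL2_embed D Phi (lower (be * ga))).
    by rewrite embed_lo.
  move=> x; rewrite !inE => /or4P[/eqP->|/eqP->|/eqP->|/orP[]/eqP->].
  - by rewrite SL2_embed1; apply: (setpow_le X1 (leq0n _)).
  - exact: up1.
  - exact: inv_mem up1.
  - exact: lo1.
  - exact: inv_mem lo1.
by have := in_setT lam; rewrite -kT inE.
Qed.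

Theorem theorem3p2 :
  exists c C : R, Rlt 0 c /\ Rlt 0 C /\
  forall (p n : nat) (X : 'M['F_p]_n -> Prop),
    prime p -> (3 <= n)%N ->
    (forall x, X x -> in_SL x) ->
    (forall x, X x -> X (invmx x)) ->
    X 1%:M ->
    (forall g, in_SL g -> in_gen X g) ->
    (exists t, X t /\ is_transvection t) ->
    exists (l : nat) (s : 'M['F_p]_n),
      Rle (INR l) (len_bound C c p n) /\ is_transvection s /\
      (forall g, transvection_group s g -> setpow X l g).
Proof.
have [D DP] := SL2_up_short; have [c [C [c0 [C0 bound]]]] := len_bound_exists D.
exists c, C; split=> //; split=> // p n X p_pr n3 XSL Xinv X1 Xgen [t [Xt tT]].
have [a a0 aP] := transvection_group_short X1 Xinv XSL Xgen Xt tT.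
have [k [m [kT kD pm]]] := DP p a p_pr a0.
exists ((2 * n ^ 2 + 1) * k)%N, t; split; last by split=> //; apply: aP.
exact: (bound p n k m (prime_gt1 p_pr) (ltnW (ltnW n3)) kD pm).
Qed.
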